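(* Let $(\mu,\nu)\in\mathcal{P}(\mathbb{T})\times\mathcal{P}(\mathbb{T})$ be $\rhd_c$-infinitely divisible. Then both $\mu$ and $\nu$ belong to $ID(\uplus\!\!\times,\mathbb{T})$. In particular, $ID(\rhd,\mathbb{T})\subset ID(\uplus\!\!\times,\mathbb{T})$.
   Context: $\mathbb{T}$ is the unit circle, $\mathbb{D}$ the open unit disc, and $\mathcal{P}(\mathbb{T})$ the Borel probability measures on $\mathbb{T}$. For $\mu\in\mathcal{P}(\mathbb{T})$ let $\psi_\mu(z)=\int\frac{z\zeta}{1-z\zeta}d\mu(\zeta)$ and $\eta_\mu=\psi_\mu/(1+\psi_\mu)$ on $\mathbb{D}$; $\eta_\mu$ determines $\mu$, and the analytic functions of this form are exactly those $\eta:\mathbb{D}\to\mathbb{C}$ with $|\eta(z)|\le|z|$. Convolutions on $\mathcal{P}(\mathbb{T})$: - Multiplicative monotone: $\eta_{\mu\rhd\nu}=\eta_\mu\circ\eta_\nu$. - Multiplicative Boolean: $\eta_{\mu\uplus\!\!\times\nu}(z)=\eta_\mu(z)\eta_\nu(z)/z$. - Multiplicative conditionally monotone, on pairs: $(\mu_1,\nu_1)\rhd_c(\mu_2,\nu_2)=(\mu,\nu)$ with $\eta_\nu=\eta_{\nu_1}\circ\eta_{\nu_2}$ and $\eta_\mu(z)=\eta_{\mu_2}(z)\,h_{\mu_1}(\eta_{\nu_2}(z))$, where $h_{\mu_1}(w)=\eta_{\mu_1}(w)/w$ and $h_{\mu_1}(0)=\eta_{\mu_1}'(0)$. For each of these operations,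 an element is infinitely divisible if for every $n\ge2$ it equals the $n$-fold convolution power of some element of $\mathcal{P}(\mathbb{T})$ (respectively of $\mathcal{P}(\mathbb{T})^2$ for $\rhd_c$). $ID(\rhd,\mathbb{T})$ and $ID(\uplus\!\!\times,\mathbb{T})$ denote the sets of $\rhd$- and $\uplus\!\!\times$-infinitely divisible probability measures on $\mathbb{T}$. *)

(* Defs.v *)
From HB Require Import structures.
From mathcomp Require Import all_boot all_order all_algebra.
From mathcomp Require Import all_classical all_reals all_analysis.
From mathcomp Require Import complex.
Set Implicit Arguments. Unset Strict Implicit. Unset Printing Implicit Defensive.
Import Order.TTheory GRing.Theory Num.Theory ComplexField.
Local Open Scope ring_scope.
Local Open Scope classical_set_scope.

(* The unit circle T is parametrised by angles: zeta(theta) = e^{i theta}. *)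
Definition zeta (R : realType) (t : R) : R[i] := (cos t +i* sin t)%C.

(* P(T): Borel probability measures on R concentrated on [0, 2 pi[ ;
   pushing forward along theta |-> e^{i theta} identifies these with P(T). *)
Definition PT (R : realType) (mu : probability (measurableTypeR R) R) : Prop :=
  mu `[0, 2 * pi[ = 1%E.

Definition cint (R : realType) (mu : probability (measurableTypeR R) R)
  (f : R -> R[i]) : R[i] :=
  ((Rintegral mu setT (fun t => complex.Re (f t))) +i*
   (Rintegral mu setT (fun t => complex.Im (f t))))%C.

Definition inD (R : realType) (z : R[i]) : Prop := `|z| < 1.

Definition psi (R : realType) (mu : probability (measurableTypeR R) R)
  (z : R[i]) : R[i] :=
  cint mu (fun t => z * zeta t / (1 - z * zeta t)).

Definition eta (R : realType) (mu : probability (measurableTypeR R) R)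
  (z : R[i]) : R[i] := psi mu z / (1 + psi mu z).

(* h_mu(w) = eta_mu(w)/w, extended at 0 by eta_mu'(0).  Since
   psi_mu(w) = w * int zeta/(1 - w zeta) dmu, we have for all w in D
   (including w = 0, where it equals eta_mu'(0) = int zeta dmu):
   h_mu(w) = (int zeta/(1 - w zeta) dmu) / (1 + psi_mu(w)). *)
Definition hfun (R : realType) (mu : probability (measurableTypeR R) R)
  (w : R[i]) : R[i] :=
  cint mu (fun t => zeta t / (1 - w * zeta t)) / (1 + psi mu w).

(* n-fold multiplicative monotone convolution power (n >= 1):
   eta of the power is eta_rho composed n times. *)
Fixpoint mono_pow (R : realType) (rho : probability (measurableTypeR R) R)
  (n : nat) : R[i] -> R[i] :=
  match n with
  | 0 | 1 => eta rho
  | k.+1 => fun z => eta rho (mono_pow rho k z)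
  end.

(* n-fold multiplicative Boolean convolution power (n >= 1):
   eta_{rho^{k+1}}(z) = eta_rho(z) eta_{rho^k}(z) / z  (value 0 at z = 0). *)
Fixpoint bool_pow (R : realType) (rho : probability (measurableTypeR R) R)
  (n : nat) : R[i] -> R[i] :=
  match n with
  | 0 | 1 => eta rho
  | k.+1 => fun z => eta rho z * bool_pow rho k z / z
  end.

(* n-fold multiplicative conditionally monotone convolution power of a pair
   (mu1, nu1) (n >= 1), as the pair (eta_mu, eta_nu) of eta-transforms:
   (mu1,nu1)^{k+1} = (mu1,nu1) |>_c (mu1,nu1)^k, i.e. with (f,g) = power k,
   eta_nu = eta_nu1 o g  and  eta_mu(z) = f(z) h_mu1(g(z)). *)
Fixpoint cm_pow (R : realType) (mu1 nu1 : probability (measurableTypeR R) R)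
  (n : nat) : (R[i] -> R[i]) * (R[i] -> R[i]) :=
  match n with
  | 0 | 1 => (eta mu1, eta nu1)
  | k.+1 => let p := cm_pow mu1 nu1 k in
            (fun z => p.1 z * hfun mu1 (p.2 z), fun z => eta nu1 (p.2 z))
  end.

Definition ID_mono (R : realType) (mu : probability (measurableTypeR R) R) :=
  forall n : nat, (2 <= n)%N ->
  exists rho : probability (measurableTypeR R) R,
    PT rho /\ forall z, inD z -> eta mu z = mono_pow rho n z.

Definition ID_bool (R : realType) (mu : probability (measurableTypeR R) R) :=
  forall n : nat, (2 <= n)%N ->
  exists rho : probability (measurableTypeR R) R,
    PT rho /\ forall z, inD z -> eta mu z = bool_pow rho n z.

Definition ID_cm (R : realType) (mu nu : probability (measurableTypeR R) R) :=
  forall n : nat, (2 <= n)%N ->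
  exists mu1 nu1 : probability (measurableTypeR R) R,
    PT mu1 /\ PT nu1 /\
    forall z, inD z ->
      eta mu z = (cm_pow mu1 nu1 n).1 z /\ eta nu z = (cm_pow mu1 nu1 n).2 z.

(* Main.v *)
Require Import Defs.
From HB Require Import structures.
From mathcomp Require Import all_boot all_order all_algebra.
From mathcomp Require Import all_classical all_reals all_analysis measurable_realfun.
From mathcomp Require Import complex ring lra.

(* A function h on the disc is analytic and bounded by 1 exactly when the kernel
   (1 - h(z) h(w)^* ) / (1 - z w^* ) is positive semidefinite. This class is
   closed under products, convex combinations and pointwise limits, and it is
   the class of the functions eta_rho(z) / z:
   - the kernel of eta_rho(z) / z is, up to a rank-one factor, the covariance of
     the variables zeta / (1 - z zeta) under rho;
   - conversely, if h is in the class, then 1 / (1 - z h(z)) is the limit of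
     E[1 / (1 - z zeta)] for atomic measures on roots of unity, whose weights are
     values of the real part of (1 + r z h(z)) / (1 - r z h(z)); encoding the
     measures by their monotone quantile functions makes the limit a pointwise
     ultralimit.

   If (mu, nu) is infinitely divisible, then f(z) = eta_mu(z) / z is, for every N,
   a product of N functions w_k of the class with a common value c at 0. If
   c = 0, then |f(z)| <= |z|^N for all N, so f = 0. Otherwise, after a rotation,
   Harnack's inequality gives 1 - w_k = O(1/N), so that the n-th power of the
   product of the convex combinations 1 - (1 - w_k) / n tends to f, and an
   ultralimit of these products is an n-th root of f in the class. The statement
   for nu follows, since (nu, nu) is infinitely divisible as well. *)

Set Implicit Arguments.
Unset Strict Implicit.
Unset Printing Implicit Defensive.
Import Order.TTheory GRing.Theory Num.Theory.
Import numFieldNormedType.Exports.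
Import ComplexField ComplexField.Normc.
Local Open Scope ring_scope.
Local Open Scope classical_set_scope.
Local Open Scope complex_scope.

(** * Modulus, conjugation and convergence in the complex numbers *)

Section ComplexPreliminaries.
Variable R : realType.
Local Notation C := R[i].
Local Notation Re := complex.Re.
Local Notation Im := complex.Im.
Implicit Types (z w : C) (F : set_system nat) (u v : nat -> C).

Lemma normcE z : `|z| = (normc z)%:C.
Proof. by []. Qed.

Lemma normc_ge0 z : 0 <= normc z.
Proof. by rewrite -ler0c -normcE. Qed.

Lemma normc_eq0 z : (normc z == 0) = (z == 0).
Proof. by rewrite -(inj_eq (@complexI R)) -normcE normr_eq0. Qed.

Lemma normcX z n : normc (z ^+ n) = normc z ^+ n.
Proof. by apply: (@complexI R); rewrite rmorphXn /= -!normcE normrX. Qed.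

Lemma normcJ z : normc z^*%R = normc z.
Proof. by apply: (@complexI R); rewrite -!normcE norm_conjC. Qed.

Lemma normc_sqr z : (normc z ^+ 2)%:C = z * z^*%R.
Proof. by rewrite rmorphXn /= -normcE normCK. Qed.

Lemma normc_opp z : normc (- z) = normc z.
Proof. exact: (@normcN R). Qed.

Lemma normcD z w : normc (z + w) <= normc z + normc w.
Proof. exact: le_normcD. Qed.

Lemma normcB z w : normc (z - w) <= normc z + normc w.
Proof. by rewrite (le_trans (normcD _ _)) // normc_opp. Qed.

Lemma normc_distC z w : normc (z - w) = normc (w - z).
Proof. by rewrite -normc_opp opprB. Qed.

Lemma normc_sum (I : Type) (s : seq I) (P : pred I) (f : I -> C) :
  normc (\sum_(i <- s | P i) f i) <= \sum_(i <- s | P i) normc (f i).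
Proof.
elim/big_ind2: _ => [|x1 x2 y1 y2 h1 h2|//]; first by rewrite normc0.
by rewrite (le_trans (normcD _ _)) // lerD.
Qed.

Lemma normc_prod (I : Type) (s : seq I) (P : pred I) (f : I -> C) :
  normc (\prod_(i <- s | P i) f i) = \prod_(i <- s | P i) normc (f i).
Proof. by apply: (big_morph _ (@normcM R) (@normc1 R)). Qed.

Lemma sum_bool (V : zmodType) (f : bool -> V) :
  \sum_i f i = f true + f false.
Proof. exact: big_bool. Qed.

Lemma normc_real (x : R) : normc x%:C = `|x|.
Proof. by rewrite /normc /= expr0n /= addr0 sqrtr_sqr. Qed.

Lemma normr_Re_le z : `|Re z| <= normc z.
Proof. by rewrite -lecR -normcE normc_ge_Re. Qed.

Lemma normr_Im_le z : `|Im z| <= normc z.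
Proof.
case: z => a b /=; rewrite -sqrtr_sqr ler_wsqrtr //.
by rewrite lerDr sqr_ge0.
Qed.

Lemma normc_le_ReIm z : normc z <= `|Re z| + `|Im z|.
Proof.
case: z => a b /=; rewrite -[leRHS]ger0_norm ?addr_ge0 // -sqrtr_sqr.
rewrite ler_wsqrtr // sqrrD !real_normK ?num_real //.
have : 0 <= `|a| * `|b| by rewrite mulr_ge0.
rewrite -mulr_natr; lra.
Qed.

Lemma inDE z : inD z <-> normc z < 1.
Proof. by rewrite /inD normcE (ltcR _ 1). Qed.

Lemma inD0 : inD (0 : C).
Proof. by apply/inDE; rewrite normc0. Qed.

Lemma sub1_neq0 z : normc z < 1 -> 1 - z != 0.
Proof. by apply: contraTneq => /eqP; rewrite subr_eq0 => /eqP <-; rewrite normc1 ltxx. Qed.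

Lemma normc_sub1_ge z : 1 - normc z <= normc (1 - z).
Proof.
by rewrite lerBlDr (le_trans _ (normcD _ _)) // subrK normc1.
Qed.

Lemma inD_mulJ_neq0 z w : inD z -> inD w -> 1 - z * w^*%R != 0.
Proof.
move=> /inDE z1 /inDE w1; apply: sub1_neq0; rewrite normcM normcJ.
by rewrite mulr_ilt1 // normc_ge0.
Qed.

Lemma cReD z w : Re (z + w) = Re z + Re w.
Proof. by case: z w => a b [c d]. Qed.
Lemma cImD z w : Im (z + w) = Im z + Im w.
Proof. by case: z w => a b [c d]. Qed.
Lemma cReM z w : Re (z * w) = Re z * Re w - Im z * Im w.
Proof. by case: z w => a b [c d]. Qed.
Lemma cImM z w : Im (z * w) = Re z * Im w + Im z * Re w.
Proof. by case: z w => a b [c d]. Qed.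
Lemma cReN z : Re (- z) = - Re z.
Proof. by case: z. Qed.
Lemma cImN z : Im (- z) = - Im z.
Proof. by case: z. Qed.
Lemma cReJ z : Re z^*%R = Re z.
Proof. by case: z. Qed.
Lemma cImJ z : Im z^*%R = - Im z.
Proof. by case: z. Qed.
Lemma cReV z : Re z^-1 = Re z / (Re z ^+ 2 + Im z ^+ 2).
Proof. by case: z. Qed.
Lemma cImV z : Im z^-1 = - (Im z / (Re z ^+ 2 + Im z ^+ 2)).
Proof. by case: z. Qed.

Lemma conjD z w : (z + w)^*%R = z^*%R + w^*%R. Proof. exact: rmorphD. Qed.
Lemma conjN z : (- z)^*%R = - z^*%R. Proof. exact: rmorphN. Qed.
Lemma conjM z w : (z * w)^*%R = z^*%R * w^*%R. Proof. exact: rmorphM. Qed.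
Lemma conjX z n : (z ^+ n)^*%R = z^*%R ^+ n. Proof. exact: rmorphXn. Qed.
Lemma conjV z : (z^-1)^*%R = (z^*%R)^-1. Proof. exact: fmorphV. Qed.
Lemma conj0 : (0 : C)^*%R = 0. Proof. exact: rmorph0. Qed.
Lemma conj1 : (1 : C)^*%R = 1. Proof. exact: rmorph1. Qed.
Lemma conj_real (x : R) : x%:C^*%R = x%:C. Proof. exact: conjc_real. Qed.
Lemma conj_sum (I : Type) (s : seq I) (P : pred I) (f : I -> C) :
  (\sum_(i <- s | P i) f i)^*%R = \sum_(i <- s | P i) (f i)^*%R.
Proof. exact: rmorph_sum. Qed.
Definition conjE := (conjD, conjN, conjM, conjX, conjV, conj0, conj1, conj_real).

Lemma realCD (x y : R) : (x + y)%:C = x%:C + y%:C. Proof. exact: rmorphD. Qed.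
Lemma realCN (x : R) : (- x)%:C = - x%:C. Proof. exact: rmorphN. Qed.
Lemma realCM (x y : R) : (x * y)%:C = x%:C * y%:C. Proof. exact: rmorphM. Qed.
Lemma realCX (x : R) n : (x ^+ n)%:C = x%:C ^+ n. Proof. exact: rmorphXn. Qed.
Lemma realC1 : (1 : R)%:C = 1. Proof. by []. Qed.
Lemma realCV (x : R) : x^-1%:C = x%:C^-1. Proof. exact: fmorphV. Qed.
Definition realCE := (realCD, realCN, realCM, realCX, realC1, realCV).

Lemma complex_eqP z w : Re z = Re w -> Im z = Im w -> z = w.
Proof. by case: z w => a b [c d] /= -> ->. Qed.

Lemma ReIm2_neq0 z : z != 0 -> Re z ^+ 2 + Im z ^+ 2 != 0.
Proof.
apply: contraNneq => h; rewrite -normc_eq0; case: z h => a b /= ->.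
by rewrite sqrtr0.
Qed.

(** Componentwise, so that the limit theorems over the reals apply; the filter is arbitrary in order
    to serve sequences and ultrafilters alike. *)
Definition cvgC F u z :=
  (fun k => Re (u k)) @ F --> Re z /\ (fun k => Im (u k)) @ F --> Im z.

Section CvgC.
Context (F : set_system nat) {FF : ProperFilter F}.

Lemma cvgC_cst z : cvgC F (fun=> z) z.
Proof. by split; apply: cvg_cst. Qed.

Lemma eq_cvgC u v z : u =1 v -> cvgC F u z -> cvgC F v z.
Proof. by move=> /funext ->. Qed.

Lemma cvgCD u v z w : cvgC F u z -> cvgC F v w ->
  cvgC F (fun k => u k + v k) (z + w).
Proof.
move=> [u1 u2] [v1 v2]; split.
  by rewrite cReD; under eq_fun do rewrite cReD; exact: cvgD.
by rewrite cImD; under eq_fun do rewrite cImD; exact: cvgD.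
Qed.

Lemma cvgCN u z : cvgC F u z -> cvgC F (fun k => - u k) (- z).
Proof.
move=> [u1 u2]; split.
  by rewrite cReN; under eq_fun do rewrite cReN; exact: cvgN.
by rewrite cImN; under eq_fun do rewrite cImN; exact: cvgN.
Qed.

Lemma cvgCB u v z w : cvgC F u z -> cvgC F v w ->
  cvgC F (fun k => u k - v k) (z - w).
Proof. by move=> hu hv; apply: cvgCD => //; apply: cvgCN. Qed.

Lemma cvgCM u v z w : cvgC F u z -> cvgC F v w ->
  cvgC F (fun k => u k * v k) (z * w).
Proof.
move=> [u1 u2] [v1 v2]; split.
  by rewrite cReM; under eq_fun do rewrite cReM; apply: cvgB; exact: cvgM.
by rewrite cImM; under eq_fun do rewrite cImM; apply: cvgD; exact: cvgM.
Qed.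

Lemma cvgCX u z n : cvgC F u z -> cvgC F (fun k => u k ^+ n) (z ^+ n).
Proof.
move=> hu; elim: n => [|n IH].
  by rewrite expr0; apply: eq_cvgC (cvgC_cst 1) => k; rewrite expr0.
by rewrite exprS; apply: eq_cvgC (cvgCM hu IH) => k; rewrite exprS.
Qed.

Lemma cvgCJ u z : cvgC F u z -> cvgC F (fun k => (u k)^*%R) z^*%R.
Proof.
move=> [u1 u2]; split.
  by rewrite cReJ; under eq_fun do rewrite cReJ.
by rewrite cImJ; under eq_fun do rewrite cImJ; exact: cvgN.
Qed.

Lemma cvgCV u z : z != 0 -> cvgC F u z -> cvgC F (fun k => (u k)^-1) z^-1.
Proof.
move=> z0 [u1 u2].
have h : (fun k => (Re (u k) ^+ 2 + Im (u k) ^+ 2)^-1) @ F -->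
         (Re z ^+ 2 + Im z ^+ 2)^-1.
  apply: cvgV; first exact: ReIm2_neq0.
  by under eq_fun do rewrite !expr2; rewrite !expr2; apply: cvgD; exact: cvgM.
split.
  by rewrite cReV; under eq_fun do rewrite cReV; exact: cvgM.
by rewrite cImV; under eq_fun do rewrite cImV; apply: cvgN; exact: cvgM.
Qed.

Lemma cvgC_sum (I : Type) (s : seq I) (f : I -> nat -> C) (l : I -> C) :
  (forall i, cvgC F (f i) (l i)) ->
  cvgC F (fun k => \sum_(i <- s) f i k) (\sum_(i <- s) l i).
Proof.
move=> h; elim: s => [|i s IH].
  by rewrite big_nil; apply: eq_cvgC (cvgC_cst 0) => k; rewrite big_nil.
by rewrite big_cons; apply: eq_cvgC (cvgCD (h i) IH) => k; rewrite big_cons.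
Qed.

Lemma cvgC_ge0 u z : (forall k, 0 <= u k) -> cvgC F u z -> 0 <= z.
Proof.
move=> u0 [u1 u2]; rewrite lecE /=; apply/andP; split.
  have E : (fun k => Im (u k)) = fun=> 0.
    by apply/funext => k; have := u0 k; rewrite lecE /= => /andP[/eqP].
  rewrite E in u2; apply/eqP; apply: cvg_unique u2 (cvg_cst _).
  exact: Rhausdorff.
rewrite -(cvg_lim (@Rhausdorff R) u1); apply: limr_ge.
  by apply/cvg_ex; exists (Re z).
by apply: nearW => k; have := u0 k; rewrite lecE => /andP[].
Qed.

Lemma cvgC_unique u z w : cvgC F u z -> cvgC F u w -> z = w.
Proof.
move=> [u1 u2] [v1 v2]; apply: complex_eqP.
  by apply: cvg_unique u1 v1; exact: Rhausdorff.
by apply: cvg_unique u2 v2; exact: Rhausdorff.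
Qed.

Lemma cvgC_bound u z (e : nat -> R) : (forall k, normc (u k - z) <= e k) ->
  e @ F --> (0 : R) -> cvgC F u z.
Proof.
move=> h /cvgrPdist_le e0; split; apply/cvgrPdist_le => eps eps0.
- near=> k; rewrite distrC -cReN -cReD.
  rewrite (le_trans (normr_Re_le _)) // (le_trans (h _)) //.
  have : `|0 - e k| <= eps by near: k; exact: e0.
  by rewrite sub0r normrN; apply: le_trans; rewrite ler_norm.
- near=> k; rewrite distrC -cImN -cImD.
  rewrite (le_trans (normr_Im_le _)) // (le_trans (h _)) //.
  have : `|0 - e k| <= eps by near: k; exact: e0.
  by rewrite sub0r normrN; apply: le_trans; rewrite ler_norm.
Unshelve. all: by end_near. Qed.

End CvgC.

Lemma geometric_cvg0 (q c : R) : 0 <= q < 1 ->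
  (fun k => c * q ^+ k) @ \oo --> (0 : R).
Proof.
move=> /andP[q0 q1]; rewrite -(mulr0 c); apply: cvgM; first exact: cvg_cst.
by apply: cvg_expr; rewrite ger0_norm.
Qed.

Lemma geometric_sum (K : pzRingType) (x : K) m :
  (1 - x) * (\sum_(i < m) x ^+ i) = 1 - x ^+ m.
Proof. by rewrite -[RHS]opprB subrX1 -mulNr opprB. Qed.

Lemma cvgC_geometric z : normc z < 1 ->
  cvgC \oo (fun m => \sum_(k < m) z ^+ k) (1 - z)^-1.
Proof.
move=> z1.
have z1' := sub1_neq0 z1.
have E m : \sum_(k < m) z ^+ k = (1 - z ^+ m) / (1 - z).
  by rewrite -geometric_sum mulrAC mulfV // mul1r.
under [X in cvgC _ X]eq_fun do rewrite E.
apply: (@cvgC_bound _ _ _ _ (fun m => (normc (1 - z))^-1 * normc z ^+ m)); last first.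
  by apply: geometric_cvg0; rewrite normc_ge0.
move=> m; rewrite mulrBl mul1r addrAC subrr sub0r normc_opp normcM normcX normcV.
by rewrite mulrC.
Qed.

End ComplexPreliminaries.

(** * Positive semidefinite kernels and the Schur class *)

Section SchurClass.
Variable R : realType.
Local Notation C := R[i].
Implicit Types (K : C -> C -> C) (f g h : C -> C).

(** Any finite type may index the points; [unit], [bool] and a sum type serve later. In the order of
    [R[i]], [0 <= x] also says that [x] is real. *)
Definition psd K := forall (I : finType) (z a : I -> C),
  (forall i, inD (z i)) ->
  0 <= \sum_i \sum_j a i * (a j)^*%R * K (z i) (z j).

Lemma eq_psd K K' :
  (forall z w, inD z -> inD w -> K z w = K' z w) -> psd K -> psd K'.
Proof.
move=> KK' hK I z a hz; under eq_bigr do under eq_bigr do rewrite -KK'//.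
exact: hK.
Qed.

Lemma psd_add K K' : psd K -> psd K' -> psd (fun z w => K z w + K' z w).
Proof.
move=> hK hK' I z a hz.
under eq_bigr do under eq_bigr do rewrite mulrDr.
under eq_bigr do rewrite big_split /=.
by rewrite big_split addr_ge0 ?hK ?hK'.
Qed.

Lemma psd_conj_mul K g : psd K -> psd (fun z w => g z * (g w)^*%R * K z w).
Proof.
move=> hK I z a hz; have := hK I z (fun i => a i * g (z i)) hz.
congr (0 <= _); apply: eq_bigr => i _; apply: eq_bigr => j _.
rewrite !conjE; ring.
Qed.

Lemma psd_scale (c : R) K : 0 <= c -> psd K -> psd (fun z w => c%:C * K z w).
Proof.
move=> c0 hK I z a hz.
under eq_bigr do under eq_bigr do rewrite mulrCA.
under eq_bigr do rewrite -mulr_sumr.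
by rewrite -mulr_sumr mulr_ge0 ?ler0c ?hK.
Qed.

Lemma psd1 : psd (fun _ _ => 1).
Proof.
move=> I z a _.
have -> : \sum_i \sum_j a i * (a j)^*%R * 1 = (\sum_i a i) * (\sum_i a i)^*%R.
  rewrite conj_sum mulr_suml; apply: eq_bigr => i _.
  by rewrite mulr_sumr; apply: eq_bigr => j _; rewrite mulr1.
exact: mul_conjC_ge0.
Qed.

Lemma psd_rank1 g : psd (fun z w => g z * (g w)^*%R).
Proof.
by apply: eq_psd (psd_conj_mul g psd1) => z w _ _; rewrite mulr1.
Qed.

Lemma psd_cvg (F : set_system nat) {FF : ProperFilter F}
    (K_ : nat -> C -> C -> C) K : (forall k, psd (K_ k)) ->
  (forall z w, inD z -> inD w -> cvgC F (fun k => K_ k z w) (K z w)) -> psd K.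
Proof.
move=> hK hF I z a hz.
apply: (@cvgC_ge0 R F FF
  (fun k => \sum_i \sum_j a i * (a j)^*%R * K_ k (z i) (z j))).
  by move=> k; exact: hK.
apply: cvgC_sum => i; apply: cvgC_sum => j; apply: cvgCM; last exact: hF.
exact: cvgC_cst.
Qed.

Definition szego (z w : C) : C := (1 - z * w^*%R)^-1.

(** The partial sums of the geometric series are sums of rank-one kernels. *)
Lemma psd_szego : psd szego.
Proof.
apply: (@psd_cvg \oo _ (fun m z w => \sum_(k < m) (z * w^*%R) ^+ k)).
  elim=> [|m IH].
    move=> I z a _; rewrite big1 // => i _.
    by rewrite big1 // => j _; rewrite big_ord0 mulr0.
  apply: eq_psd (psd_add IH (psd_rank1 (fun z => z ^+ m))) => z w _ _ /=.
  by rewrite big_ord_recr /= exprMn rmorphXn.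
move=> z w /inDE z1 /inDE w1; apply: cvgC_geometric.
by rewrite normcM normcJ mulr_ilt1 // normc_ge0.
Qed.

Lemma szegoE z w : inD z -> inD w -> szego z w = 1 + z * w^*%R * szego z w.
Proof.
move=> hz hw; have h := inD_mulJ_neq0 hz hw; rewrite /szego.
by field.
Qed.

Definition schur h := psd (fun z w => (1 - h z * (h w)^*%R) * szego z w).

Lemma eq_schur g h : (forall z, inD z -> g z = h z) -> schur g -> schur h.
Proof. by move=> gh; apply: eq_psd => z w hz hw; rewrite !gh. Qed.

(** With primes for conjugates of values at [w], [1 - g h g' h' = (1 - g g') + g g' (1 - h h')]. *)
Lemma schur_mul g h : schur g -> schur h -> schur (fun z => g z * h z).
Proof.
move=> hg hh; apply: eq_psd (psd_add hg (psd_conj_mul g hh)) => z w _ _.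
rewrite !conjE; ring.
Qed.

(** For the convex combination [f], with primes for conjugates of values at [w], [1 - f f' = l (1 -
    g g') + (1 - l) (1 - h h') + l (1 - l) (g - h) (g - h)']. *)
Lemma schur_conv (l : R) g h : 0 <= l <= 1 -> schur g -> schur h ->
  schur (fun z => l%:C * g z + (1 - l)%:C * h z).
Proof.
move=> /andP[l0 l1] hg hh.
have l1' : 0 <= 1 - l by rewrite subr_ge0.
have := psd_scale (mulr_ge0 l0 l1') (psd_conj_mul (fun z => g z - h z) psd_szego).
move=> /(psd_add (psd_add (psd_scale l0 hg) (psd_scale l1' hh))).
apply: eq_psd => z w _ _.
rewrite !conjE !realCE; ring.
Qed.

Lemma schur_cst (c : C) : normc c <= 1 -> schur (fun=> c).
Proof.
move=> c1; have c2 : 0 <= 1 - normc c ^+ 2.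
  by rewrite subr_ge0 expr_le1 // normc_ge0.
apply: eq_psd (psd_scale c2 psd_szego) => z w _ _.
by rewrite realCD realCN normc_sqr.
Qed.

Lemma schur_id : schur id.
Proof.
apply: eq_psd psd1 => z w hz hw; rewrite /szego mulfV //.
exact: inD_mulJ_neq0.
Qed.

Lemma schur_prod (I : Type) (s : seq I) (f : I -> C -> C) :
  (forall i, schur (f i)) -> schur (fun z => \prod_(i <- s) f i z).
Proof.
move=> hf; elim: s => [|i s IH].
  apply: eq_schur (schur_cst (c := 1) _) => [z _|]; first by rewrite big_nil.
  by rewrite normc1.
by apply: eq_schur (schur_mul (hf i) IH) => z _; rewrite big_cons.
Qed.

Lemma schur_cvg (F : set_system nat) {FF : ProperFilter F}
    (h_ : nat -> C -> C) h : (forall k, schur (h_ k)) ->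
  (forall z, inD z -> cvgC F (fun k => h_ k z) (h z)) -> schur h.
Proof.
move=> hh hF; apply: (psd_cvg (F := F)) hh _ => z w hz hw.
apply: cvgCM; last exact: cvgC_cst.
apply: cvgCB; first exact: cvgC_cst.
by apply: cvgCM; [exact: hF | apply: cvgCJ; exact: hF].
Qed.

(** The kernel is [(1 - h h') S + h h' (z w' S)] with [S] the Szego kernel and primes for
    conjugates, because [z w' S = S - 1]. It expresses that [h] lies in the unit ball of the Hardy
    space. *)
Lemma schur_szego_sub h : schur h ->
  psd (fun z w => szego z w - h z * (h w)^*%R).
Proof.
move=> hh; have := psd_conj_mul h (psd_conj_mul id psd_szego).
move=> /(psd_add hh); apply: eq_psd => z w hz hw /=.
have -> : z * w^*%R * szego z w = szego z w - 1.
  by rewrite [in RHS]szegoE // addrAC subrr add0r.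
ring.
Qed.

(** In the Hardy space, a combination of point evaluations is bounded by its norm, whose square is
    the Szego form on the right. *)
Lemma schur_functional h (I : finType) (z a : I -> C) : schur h ->
  (forall i, inD (z i)) ->
  (normc (\sum_i a i * h (z i)) ^+ 2)%:C <=
  \sum_i \sum_j a i * (a j)^*%R * szego (z i) (z j).
Proof.
move=> hh hz; rewrite -subr_ge0; have := schur_szego_sub hh a hz.
congr (0 <= _); rewrite normc_sqr conj_sum mulr_suml -sumrB.
apply: eq_bigr => i _; rewrite mulr_sumr -sumrB; apply: eq_bigr => j _.
rewrite !conjE; ring.
Qed.

(* A functional killing the monomials of degree less than [N] only sees the
   tail of the Szego kernel. *)
Lemma schur_functional_tail h (I : finType) (z a : I -> C) N (t : R) : schur h ->
  t < 1 -> (forall i, normc (z i) <= t) ->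
  (forall l, (l < N)%N -> \sum_i a i * z i ^+ l = 0) ->
  normc (\sum_i a i * h (z i)) <= (\sum_i normc (a i)) * t ^+ N / (1 - t).
Proof.
move=> hh t1 hzt ha.
(* A negative [t] forces [I] to be empty. *)
have [t0|t0] := ltP t 0.
  have I0 (i : I) : False by have := le_trans (normc_ge0 _) (hzt i); rewrite leNgt t0.
  by rewrite !big1 ?normc0 ?mul0r // => i; have := I0 i.
have hz i : inD (z i) by apply/inDE; exact: le_lt_trans (hzt i) t1.
have Ht i j : normc (z i * (z j)^*%R) <= t ^+ 2.
  by rewrite normcM normcJ expr2 ler_pM ?normc_ge0.
(* Each induction step replaces the kernel by its tail through [szegoE]; the discarded term of
   degree [N] is the squared modulus of a vanishing moment. *)
have E : \sum_i \sum_j a i * (a j)^*%R * szego (z i) (z j) =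
    \sum_i \sum_j a i * (a j)^*%R * ((z i * (z j)^*%R) ^+ N * szego (z i) (z j)).
  elim: N ha {hzt Ht} => [|N IH] ha.
    by apply: eq_bigr => i _; apply: eq_bigr => j _; rewrite expr0 mul1r.
  rewrite IH; last by move=> l lN; apply: ha; exact: ltnW.
  have E0 : \sum_i \sum_j a i * (a j)^*%R * (z i * (z j)^*%R) ^+ N = 0.
    apply/esym; transitivity ((\sum_i a i * z i ^+ N) * (\sum_i a i * z i ^+ N)^*%R).
      by rewrite ha // mul0r.
    rewrite conj_sum mulr_suml; apply: eq_bigr => i _.
    rewrite mulr_sumr; apply: eq_bigr => j _.
    rewrite !conjE exprMn; ring.
  apply/eqP; rewrite -subr_eq0; apply/eqP; rewrite -[RHS]E0 -sumrB; apply: eq_bigr => i _.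
  rewrite -sumrB; apply: eq_bigr => j _.
  by rewrite [in X in X - _]szegoE // exprS; ring.
have A0 : 0 <= \sum_i normc (a i) by apply: sumr_ge0 => i _; exact: normc_ge0.
have := schur_functional a hh hz; rewrite E => H.
have {}H : normc (\sum_i a i * h (z i)) ^+ 2 <=
    (\sum_i normc (a i)) ^+ 2 * ((t ^+ 2) ^+ N * (1 - t ^+ 2)^-1).
  (* The Szego form dominates a nonnegative number, so it is real and at most its own modulus. *)
  have := le_trans H (real_ler_norm (ger0_real (le_trans _ H))).
  rewrite ler0c sqr_ge0 => /(_ isT); rewrite normcE lecR => /le_trans; apply.
  rewrite (le_trans (normc_sum _ _ _)) // expr2 mulr_suml mulr_suml.
  apply: ler_sum => i _; rewrite (le_trans (normc_sum _ _ _)) //.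
  rewrite mulr_sumr mulr_suml; apply: ler_sum => j _.
  rewrite normcM normcM normcJ ler_wpM2l ?mulr_ge0 ?normc_ge0 //.
  rewrite normcM normcX normcV ler_pM ?exprn_ge0 ?invr_ge0 ?normc_ge0 //.
    by rewrite lerXn2r ?nnegrE ?normc_ge0 ?sqr_ge0.
  rewrite lef_pV2 ?posrE ?subr_gt0 //.
  - by rewrite (le_trans _ (normc_sub1_ge _)) // lerB.
  - by rewrite lt_neqAle normc_ge0 eq_sym normc_eq0 inD_mulJ_neq0.
  - by rewrite expr_lt1.
have t1' : 0 < 1 - t by rewrite subr_gt0.
rewrite -ler_sqr ?nnegrE ?normc_ge0 //; last first.
  by rewrite !mulr_ge0 ?exprn_ge0 // invr_ge0 ltW.
rewrite (le_trans H) // !exprMn -mulrA ler_wpM2l ?sqr_ge0 //.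
rewrite -expr2 ler_wpM2l ?sqr_ge0 // exprVn lef_pV2 ?posrE; nra.
Qed.

End SchurClass.

(** * Pointwise estimates for Schur functions *)

Section SchurEstimates.
Variable R : realType.
Local Notation C := R[i].
Local Notation Re := complex.Re.
Implicit Types (h : C -> C) (z w : C).

Lemma normc_lt1_sqr z : inD z -> 0 < 1 - normc z ^+ 2.
Proof. by move=> /inDE z1; rewrite subr_gt0 expr_lt1 // normc_ge0. Qed.

Lemma szego_diag z : szego z z = ((1 - normc z ^+ 2)^-1)%:C.
Proof. by rewrite /szego -normc_sqr realCV realCD realCN. Qed.

Lemma schur_le1 h z : schur h -> inD z -> normc (h z) <= 1.
Proof.
move=> hh hz; have := hh unit (fun=> z) (fun=> 1) (fun=> hz).
rewrite !(big_pred1 tt) /=; do ?by case.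
rewrite conj1 !mul1r szego_diag -normc_sqr -realC1 -realCN -realCD -realCM.
rewrite ler0c pmulr_lge0 ?invr_gt0 ?normc_lt1_sqr // subr_ge0 => h1.
by rewrite -(@expr_le1 _ 2) // normc_ge0.
Qed.

(** This is the kernel form at the points [z] and [0]; the Szego kernel equals [1] as soon as one
    argument is [0]. *)
Lemma schur_two_point h z (a b : C) : schur h -> inD z ->
  0 <= normc a ^+ 2 * ((1 - normc (h z) ^+ 2) / (1 - normc z ^+ 2)) +
    2 * Re (a * b^*%R * (1 - h z * (h 0)^*%R)) +
    normc b ^+ 2 * (1 - normc (h 0) ^+ 2).
Proof.
move=> hh hz.
have hz' (i : bool) : inD (if i then z else 0) by case: i => //; exact: inD0.
have := hh bool _ (fun i => if i then a else b) hz'.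
rewrite lecE => /andP[_]; rewrite !sum_bool; cbv beta iota.
rewrite szego_diag /szego !conjE !mulr0 !mul0r !subr0 invr1 !mulr1.
have -> : h 0 * (h z)^*%R = (h z * (h 0)^*%R)^*%R by rewrite conjM conjCK mulrC.
rewrite -!normc_sqr.
set k := h z * (h 0)^*%R; clearbody k.
have -> : b * a^*%R * (1 - k^*%R) = (a * b^*%R * (1 - k))^*%R.
  by rewrite !conjE (conjCK b); ring.
set x := a * b^*%R * (1 - k).
rewrite -realC1 -!realCN -!realCD -!realCM !cReD cReJ /=; lra.
Qed.

(** With coefficients [1] and [-1] the two-point form becomes [(1 - |h(z)|^2) / (1 - |z|^2) - 1]. *)
Lemma schur_schwarz h z : schur h -> h 0 = 0 -> inD z -> normc (h z) <= normc z.
Proof.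
move=> hh h0 hz; have := schur_two_point 1 (-1) hh hz.
have z1 := normc_lt1_sqr hz.
rewrite h0 conj0 mulr0 subr0 !conjE normc_opp !normc1 normc0 mulr1 expr0n /=.
rewrite subr0 expr1n !mul1r -(pmulr_rge0 _ z1) => H.
rewrite -ler_sqr ?nnegrE ?normc_ge0 //.
move: H; rewrite mulrDr mulrDr mulrCA mulfV ?gt_eqF // !mulr1.
lra.
Qed.

(** The determinant of the two-point kernel matrix is nonnegative. *)
Lemma schur_cauchy_schwarz h z : schur h -> inD z ->
  normc (1 - h z * (h 0)^*%R) ^+ 2 * (1 - normc z ^+ 2) <=
  (1 - normc (h z) ^+ 2) * (1 - normc (h 0) ^+ 2).
Proof.
move=> hh hz; have z1 := normc_lt1_sqr hz.
have P0 : 0 <= 1 - normc (h z) ^+ 2.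
  by rewrite subr_ge0 expr_le1 ?normc_ge0 ?schur_le1.
have B0 : 0 <= 1 - normc (h 0) ^+ 2.
  by rewrite subr_ge0 expr_le1 ?normc_ge0 ?schur_le1 //; exact: inD0.
rewrite -ler_pdivlMr // mulrAC.
set P := _ / _; have {P0}P0 : 0 <= P by rewrite divr_ge0 // ltW.
set B := 1 - _ in B0 *; set k := 1 - _.
(* Taking [b] along [k] makes the cross term real and leaves a real quadratic form in [s] and
   [t]. *)
have H (s t : R) : 0 <= s ^+ 2 * P - 2 * (s * t) * normc k ^+ 2 +
    t ^+ 2 * normc k ^+ 2 * B.
  have := schur_two_point s%:C (- (t%:C * k)) hh hz; rewrite -/k -/B -/P.
  have -> : s%:C * (- (t%:C * k))^*%R * k = - (s * t * normc k ^+ 2)%:C.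
    by rewrite conjN conjM conj_real realCM normc_sqr realCM; ring.
  rewrite normc_opp normcM !normc_real exprMn !real_normK ?num_real // cReN /=.
  lra.
clearbody P B k; have k0 := sqr_ge0 (normc k).
have [B0'|] := eqVneq B 0; last first.
  move=> B1; have {}B1 : 0 < B by rewrite lt_neqAle eq_sym B1.
  have BV : 0 < B^-1 by rewrite invr_gt0.
  have := H B 1; rewrite -(pmulr_rge0 _ BV).
  have -> : B^-1 * (B ^+ 2 * P - 2 * (B * 1) * normc k ^+ 2 +
    1 ^+ 2 * normc k ^+ 2 * B) = P * B - normc k ^+ 2.
    by field; rewrite gt_eqF.
  by rewrite subr_ge0.
(* For [B = 0] the form is affine in [t]; the chosen [t] would give it the negative value
   [- P - 2]. *)
rewrite B0' mulr0 leNgt; apply/negP => k1.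
have := H 1 ((P + 1) / normc k ^+ 2); rewrite B0' mulr0 addr0 expr1n mul1r mul1r.
rewrite -mulrA mulfVK ?gt_eqF //; lra.
Qed.

(** Let [x = |1 - h(z) h(0)|] and [y = 1 - |z|^2]. Since [1 - |h(z)| <= x], the determinant
    inequality gives [x^2 y <= (2 x) (2 d)], so [x <= 4 d / y]. Replacing [h(0)] by [1] costs at
    most a further [d <= d / y], whence the constant [5]. *)
Lemma schur_harnack h z (d : R) : schur h -> inD z -> 0 <= d <= 1 ->
  h 0 = (1 - d)%:C -> normc (1 - h z) <= 5 / (1 - normc z ^+ 2) * d.
Proof.
move=> hh hz /andP[d0 d1] h0; have := schur_cauchy_schwarz hh hz.
have z1 := normc_lt1_sqr hz; have hz1 := schur_le1 hh hz.
rewrite h0 conj_real normc_real ger0_norm ?subr_ge0 //.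
set x := normc (1 - _).
have x0 : 0 <= x := normc_ge0 _.
have h1 := normc_ge0 (h z).
have xh : 1 - normc (h z) <= x.
  rewrite (le_trans _ (normc_sub1_ge _)) // lerB // normcM normc_real.
  by rewrite ger0_norm ?subr_ge0 // ler_piMr // gerBl.
have le1 : normc (1 - h z) <= x + d.
  have -> : 1 - h z = (1 - h z * (1 - d)%:C) - h z * d%:C.
    by rewrite realCD realCN; ring.
  rewrite (le_trans (normcB _ _)) // lerD // normcM normc_real ger0_norm //.
  by rewrite ler_piMl.
move=> H; set y := 1 - normc z ^+ 2 in z1 H *.
have y1 : y <= 1 by rewrite gerBl sqr_ge0.
have H1 : x * y <= 4 * d.
  have [->|x1] := eqVneq x 0; first by rewrite mul0r mulr_ge0.
  have {}x1 : 0 < x by rewrite lt_neqAle eq_sym x1.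
  rewrite -(ler_pM2l x1); apply: le_trans (_ : (2 * x) * (2 * d) <= _); last nra.
  rewrite mulrA -expr2; apply: le_trans H _; apply: ler_pM; nra.
rewrite (le_trans le1) // mulrAC ler_pdivlMr //; nra.
Qed.

(** The functional [f |-> f(z) - f(0)] kills constants, so the tail bound applies with [N = 1]. *)
Lemma schur_lipschitz0 h z (t : R) : schur h -> normc z <= t -> t < 1 ->
  normc (h z - h 0) <= 2 * t / (1 - t).
Proof.
move=> hh zt t1; have t0 := le_trans (normc_ge0 z) zt.
have := @schur_functional_tail R h bool (fun i => if i then z else 0)
  (fun i => if i then 1 else -1) 1 t hh t1.
rewrite !sum_bool; cbv beta iota; rewrite normc_opp !normc1 mul1r mulN1r expr1; apply.
  by case=> //; rewrite normc0.
by case=> // _; rewrite sum_bool !expr0 !mulr1 subrr.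
Qed.

(** Both functions are continuous at [0] by [schur_lipschitz0]. This recovers the value at [0] of
    quotients by [z]. *)
Lemma schur_eq0 g h : schur g -> schur h ->
  (forall z, inD z -> z != 0 -> g z = h z) -> g 0 = h 0.
Proof.
move=> hg hh gh; apply/eqP; rewrite -subr_eq0 -normc_eq0 eq_le normc_ge0 andbT.
apply/ler_addgt0Pl => e e0; rewrite addr0.
pose t : R := Num.min (1 / 2) (e / 8).
have t0 : 0 < t by rewrite lt_min; apply/andP; split; lra.
have t1 : t <= 1 / 2 by rewrite ge_min lexx.
have t2 : t <= e / 8 by rewrite ge_min lexx orbT.
have nt : normc t%:C = t by rewrite normc_real gtr0_norm.
have ht : inD t%:C by apply/inDE; rewrite nt; lra.
have t3 : t < 1 by lra.
have H h' : schur h' -> normc (h' t%:C - h' 0) <= e / 2.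
  move=> hh'; rewrite (le_trans (schur_lipschitz0 hh' _ t3)) ?nt //.
  by rewrite ler_pdivrMr ?subr_gt0 //; nra.
have -> : g 0 - h 0 = (h t%:C - h 0) - (g t%:C - g 0).
  rewrite (gh t%:C) //; first by ring.
  by rewrite -normc_eq0 nt gt_eqF.
rewrite (le_trans (normcB _ _)) // (splitr e) lerD ?H //.
Qed.

(** The squared norm of [f |-> f(z) - f(r z)] is a combination of four Szego values, all real
    because [r] is; their sum carries a factor [1 - r]. *)
Lemma schur_radial h z (r : R) : schur h -> inD z -> 0 <= r <= 1 ->
  normc (h z - h (r%:C * z)) ^+ 2 <= (1 - r) / (1 - normc z ^+ 2) ^+ 2.
Proof.
move=> hh hz /andP[r0 r1]; have z1 := normc_lt1_sqr hz.
have hrz : inD (r%:C * z).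
  apply/inDE; rewrite normcM normc_real ger0_norm //; move/inDE: hz.
  by apply: le_lt_trans; rewrite ler_piMl // normc_ge0.
have hz' (i : bool) : inD (if i then z else r%:C * z) by case: i.
have := schur_functional (fun i => if i then 1 else -1) hh hz'.
rewrite !sum_bool; cbv beta iota; rewrite mul1r mulN1r lecE => /andP[_] /le_trans; apply.
set x := normc z ^+ 2 in z1 *.
have S1 : szego z (r%:C * z) = ((1 - r * x)^-1)%:C.
  by rewrite /szego realCV !conjE mulrCA -normc_sqr -realCM -realC1 -realCN -realCD.
have S2 : szego (r%:C * z) z = ((1 - r * x)^-1)%:C.
  by rewrite /szego realCV -mulrA -normc_sqr -realCM -realC1 -realCN -realCD.
rewrite S1 S2 !szego_diag normcM normc_real exprMn real_normK ?num_real // -/x.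
rewrite !conjE !mul1r !mulN1r opprK !mul1r -!realCN -!realCD /=.
have x0 : 0 <= x by exact: sqr_ge0.
have y1 : 0 < 1 - r * x by nra.
have r2 : r ^+ 2 * x <= x by rewrite ler_piMl // expr_le1.
have y2 : 0 < 1 - r ^+ 2 * x by lra.
have -> : (1 - x)^-1 - (1 - r * x)^-1 + (- (1 - r * x)^-1 + (1 - r ^+ 2 * x)^-1) =
  (1 - r) * (x / ((1 - x) * (1 - r * x)) - r * x / ((1 - r * x) * (1 - r ^+ 2 * x))).
  by field; rewrite !gt_eqF.
rewrite ler_wpM2l ?subr_ge0 //.
apply: le_trans (_ : x / ((1 - x) * (1 - r * x)) <= _).
  by rewrite gerBl divr_ge0 ?(mulr_ge0 r0 x0) ?mulr_ge0 // ltW.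
rewrite ler_pdivrMr ?mulr_gt0 // mulrC ler_pdivlMr ?exprn_gt0 //.
rewrite expr2 mulrCA -subr_ge0 -mulrBr mulr_ge0 ?(ltW z1) //; nra.
Qed.

End SchurEstimates.

(** * Integration on the circle, and [hfun mu] as a Schur function *)

Section EtaTransform.
Variable R : realType.
Local Notation C := R[i].
Local Notation Re := complex.Re.
Local Notation Im := complex.Im.
Implicit Types (f g : R -> C) (z w c : C).

Lemma bounded_integrable d (T : measurableType d) (P : probability T R)
    (f : T -> R) (M : R) : measurable_fun setT f -> (forall t, `|f t| <= M) ->
  P.-integrable setT (EFin \o f).
Proof.
move=> mf fM; apply: measurable_bounded_integrable => //.
  by rewrite (le_lt_trans (probability_le1 P measurableT)) ?ltry.
exists M; split; first exact: num_real.
by move=> x Mx t _; exact: le_trans (fM t) (ltW Mx).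
Qed.

Lemma Rintegral_prob_cst d (T : measurableType d) (P : probability T R) (c : R) :
  \int[P]_(t in setT) c = c.
Proof.
rewrite Rintegral_cst //; transitivity (c * fine (1%E : \bar R)).
  by congr (c * fine _); exact: probability_setT.
by rewrite mulr1.
Qed.

(** Such integrands are integrable for every probability measure and are stable under all operations
    used below. *)
Definition bcont f := [/\ continuous (fun t => Re (f t)),
  continuous (fun t => Im (f t)) & exists M, forall t, normc (f t) <= M].

Lemma bcont_cst c : bcont (fun=> c).
Proof. by split; try exact: cst_continuous; exists (normc c). Qed.

Lemma bcontD f g : bcont f -> bcont g -> bcont (fun t => f t + g t).
Proof.
move=> [f1 f2 [M fM]] [g1 g2 [N gN]]; split.
- by move=> t; under eq_fun do rewrite cReD; apply: cvgD; [exact: f1|exact: g1].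
- by move=> t; under eq_fun do rewrite cImD; apply: cvgD; [exact: f2|exact: g2].
- by exists (M + N) => t; rewrite (le_trans (normcD _ _)) // lerD.
Qed.

Lemma bcontM f g : bcont f -> bcont g -> bcont (fun t => f t * g t).
Proof.
move=> [f1 f2 [M fM]] [g1 g2 [N gN]]; split.
- move=> t; under eq_fun do rewrite cReM; apply: cvgB; apply: cvgM.
  + exact: f1. + exact: g1. + exact: f2. + exact: g2.
- move=> t; under eq_fun do rewrite cImM; apply: cvgD; apply: cvgM.
  + exact: f1. + exact: g2. + exact: f2. + exact: g1.
- by exists (M * N) => t; rewrite normcM ler_pM ?normc_ge0.
Qed.

Lemma bcontZ c f : bcont f -> bcont (fun t => c * f t).
Proof. exact: bcontM (bcont_cst c). Qed.

Lemma bcontB f g : bcont f -> bcont g -> bcont (fun t => f t - g t).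
Proof.
move=> bf bg; under eq_fun do rewrite -mulN1r.
exact: bcontD bf (bcontZ _ bg).
Qed.

Lemma bcontJ f : bcont f -> bcont (fun t => (f t)^*%R).
Proof.
move=> [f1 f2 [M fM]]; split.
- by move=> t; under eq_fun do rewrite cReJ; exact: f1.
- by move=> t; under eq_fun do rewrite cImJ; apply: cvgN; exact: f2.
- by exists M => t; rewrite normcJ.
Qed.

Lemma bcont_sum (I : Type) (s : seq I) (f : I -> R -> C) :
  (forall i, bcont (f i)) -> bcont (fun t => \sum_(i <- s) f i t).
Proof.
move=> hf; elim: s => [|i s IH].
  by under eq_fun do rewrite big_nil; exact: bcont_cst.
by under eq_fun do rewrite big_cons; exact: bcontD.
Qed.

Lemma bcontV f (e : R) : 0 < e -> (forall t, e <= normc (f t)) ->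
  bcont f -> bcont (fun t => (f t)^-1).
Proof.
move=> e0 fe [f1 f2 _].
have f0 t : f t != 0 by rewrite -normc_eq0 gt_eqF // (lt_le_trans e0).
have h : continuous (fun t => (Re (f t) ^+ 2 + Im (f t) ^+ 2)^-1).
  move=> t; apply: cvgV; first exact: ReIm2_neq0.
  under eq_fun do rewrite !expr2.
  by rewrite !expr2; apply: cvgD; apply: cvgM; (exact: f1 || exact: f2).
split.
- by move=> t; under eq_fun do rewrite cReV; apply: cvgM; [exact: f1|exact: h].
- by move=> t; under eq_fun do rewrite cImV; apply: cvgN; apply: cvgM;
    [exact: f2|exact: h].
- exists e^-1 => t; rewrite normcV lef_pV2 ?posrE //.
  exact: lt_le_trans e0 (fe t).
Qed.

Lemma normc_zeta t : normc (zeta t) = 1 :> R.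
Proof. by rewrite /normc /zeta cos2Dsin2 sqrtr1. Qed.

Lemma zetaJ t : zeta t * (zeta t)^*%R = 1 :> C.
Proof. by rewrite -normc_sqr normc_zeta expr1n. Qed.

Lemma bcont_zeta : bcont (@zeta R).
Proof.
split; [exact: continuous_cos | exact: continuous_sin|].
by exists 1 => t; rewrite normc_zeta.
Qed.

Lemma normc_mul_zeta z t : normc (z * zeta t) = normc z.
Proof. by rewrite normcM normc_zeta mulr1. Qed.

Lemma sub1_zeta_neq0 z t : inD z -> 1 - z * zeta t != 0.
Proof. by move=> /inDE z1; apply: sub1_neq0; rewrite normc_mul_zeta. Qed.

Lemma sub1_zeta_ge z t : 1 - normc z <= normc (1 - z * zeta t).
Proof. by rewrite -(normc_mul_zeta z t) normc_sub1_ge. Qed.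

Lemma bcont_poisson z : inD z -> bcont (fun t => (1 - z * zeta t)^-1).
Proof.
move=> hz; apply: (@bcontV _ (1 - normc z)).
- by rewrite subr_gt0; apply/inDE.
- by move=> t; exact: sub1_zeta_ge.
- by apply: bcontB; [exact: bcont_cst | apply: bcontZ; exact: bcont_zeta].
Qed.

Section Integral.
Variable mu : probability (measurableTypeR R) R.

Lemma bcont_intRe f : bcont f ->
  mu.-integrable setT (EFin \o (fun t => Re (f t))).
Proof.
move=> [f1 _ [M fM]]; apply: (@bounded_integrable _ _ _ _ M).
  exact: continuous_measurable_fun.
by move=> t; rewrite (le_trans (normr_Re_le _)).
Qed.

Lemma bcont_intIm f : bcont f ->
  mu.-integrable setT (EFin \o (fun t => Im (f t))).
Proof.
move=> [_ f2 [M fM]]; apply: (@bounded_integrable _ _ _ _ M).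
  exact: continuous_measurable_fun.
by move=> t; rewrite (le_trans (normr_Im_le _)).
Qed.

Lemma cint_cst c : cint mu (fun=> c) = c.
Proof.
by rewrite /cint !Rintegral_prob_cst; case: c.
Qed.

Lemma cintD f g : bcont f -> bcont g ->
  cint mu (fun t => f t + g t) = cint mu f + cint mu g.
Proof.
move=> bf bg; rewrite /cint.
under eq_Rintegral do rewrite cReD.
under [X in (_ +i* X)%C = _]eq_Rintegral do rewrite cImD.
by rewrite !RintegralD //; (exact: bcont_intRe || exact: bcont_intIm).
Qed.

Lemma cintZ c f : bcont f -> cint mu (fun t => c * f t) = c * cint mu f.
Proof.
move=> bf; have iR := bcont_intRe bf; have iI := bcont_intIm bf.
case: c => a b; rewrite /cint.
have iZ (r : R) (h : R -> R) : mu.-integrable setT (EFin \o h) ->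
  mu.-integrable setT (EFin \o (fun t => r * h t)).
  move=> ih; rewrite (_ : _ \o _ = fun t => (r%:E * (EFin \o h) t)%E).
    exact: integrableZl.
  by apply/funext => t; rewrite /= EFinM.
under eq_Rintegral do rewrite cReM /=.
under [X in (_ +i* X)%C = _]eq_Rintegral do rewrite cImM /=.
rewrite RintegralB ?RintegralD //; do ?exact: iZ.
by rewrite !RintegralZl.
Qed.

Lemma cintJ f : bcont f -> cint mu (fun t => (f t)^*%R) = (cint mu f)^*%R.
Proof.
move=> bf; rewrite /cint; apply: complex_eqP; rewrite ?cReJ ?cImJ /=.
  by under eq_Rintegral do rewrite cReJ.
rewrite -mulN1r -RintegralZl //; last exact: bcont_intIm.
by apply: eq_Rintegral => t _; rewrite cImJ mulN1r.
Qed.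

Lemma cint_sum (I : Type) (s : seq I) (f : I -> R -> C) :
  (forall i, bcont (f i)) ->
  cint mu (fun t => \sum_(i <- s) f i t) = \sum_(i <- s) cint mu (f i).
Proof.
move=> hf; elim: s => [|i s IH].
  rewrite big_nil; under eq_fun do rewrite big_nil; exact: cint_cst.
rewrite big_cons; under eq_fun do rewrite big_cons.
by rewrite cintD ?IH //; exact: bcont_sum.
Qed.

Lemma cint_ge0 f : (forall t, 0 <= f t) -> 0 <= cint mu f.
Proof.
move=> f0; rewrite lecE /=; apply/andP; split; last first.
  by apply: Rintegral_ge0 => t _; have := f0 t; rewrite lecE => /andP[].
apply/eqP; rewrite -[RHS](Rintegral_prob_cst mu 0).
by apply: eq_Rintegral => t _; have := f0 t; rewrite lecE => /andP[/eqP].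
Qed.

Lemma psi1E z : inD z -> 1 + psi mu z = cint mu (fun t => (1 - z * zeta t)^-1).
Proof.
move=> hz; rewrite -[X in X + _](cint_cst 1) /psi -cintD; first last.
- apply: bcontM; first by apply: bcontZ; exact: bcont_zeta.
  exact: bcont_poisson.
- exact: bcont_cst.
congr cint; apply/funext => t; have h := sub1_zeta_neq0 t hz.
by field.
Qed.

(** The map [1 / (1 - z)] sends the disc into the half-plane [Re > 1 / 2]. Both [1 + psi mu z != 0]
    and the positivity of the quadrature weights rest on this. *)
Lemma Re_inv_sub1_gt z : normc z < 1 -> 1 / 2 < Re (1 - z)^-1.
Proof.
move=> z1; have z0 := sub1_neq0 z1.
have : normc z ^+ 2 < 1 by rewrite expr_lt1 // normc_ge0.
rewrite cReV; have := ReIm2_neq0 z0; case: z z1 z0 => a b /= _ _.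
rewrite sub0r sqrrN sqr_sqrtr ?addr_ge0 ?sqr_ge0 // => h ab.
have h1 : 0 < (1 - a) ^+ 2 + b ^+ 2.
  by rewrite lt_neqAle eq_sym h addr_ge0 ?sqr_ge0.
rewrite ltr_pdivlMr //; nra.
Qed.

Lemma psi1_neq0 z : inD z -> 1 + psi mu z != 0.
Proof.
move=> hz; apply: contraTneq (lexx (1 / 2 : R)) => h.
have : 1 / 2 <= Re (1 + psi mu z).
  rewrite psi1E // /cint /= -[leLHS](Rintegral_prob_cst mu).
  apply: le_Rintegral => //.
  - by apply: (@bounded_integrable _ _ _ _ `|1 / 2|).
  - exact: bcont_intRe (bcont_poisson hz).
  - by move=> t _; apply/ltW/Re_inv_sub1_gt; rewrite normc_mul_zeta; apply/inDE.
rewrite h /= => h2; lra.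
Qed.

Lemma bcont_cauchy z : inD z -> bcont (fun t => zeta t / (1 - z * zeta t)).
Proof. by move=> hz; apply: bcontM; [exact: bcont_zeta|exact: bcont_poisson]. Qed.

Lemma psiE z : inD z ->
  psi mu z = z * cint mu (fun t => zeta t / (1 - z * zeta t)).
Proof.
move=> hz; rewrite -cintZ; last exact: bcont_cauchy.
by congr cint; apply/funext => t; rewrite mulrA.
Qed.

Lemma eta_hfun z : inD z -> Defs.eta mu z = z * hfun mu z.
Proof. by move=> hz; rewrite /Defs.eta psiE // /hfun mulrA -psiE. Qed.

Definition ccauchy z t :=
  zeta t / (1 - z * zeta t) - cint mu (fun t => zeta t / (1 - z * zeta t)).

Lemma bcont_ccauchy z : inD z -> bcont (ccauchy z).
Proof.
move=> hz; apply: bcontB; first exact: bcont_cauchy.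
exact: bcont_cst.
Qed.

(** The last factor is a covariance, computed as the mean of a product minus the product of the
    means. *)
Lemma hfun_kernel z w : inD z -> inD w ->
  1 - hfun mu z * (hfun mu w)^*%R =
  (1 + psi mu z)^-1 * ((1 + psi mu w)^-1)^*%R * (1 - z * w^*%R) *
  cint mu (fun t => ccauchy z t * (ccauchy w t)^*%R).
Proof.
move=> hz hw; have z0 := psi1_neq0 hz; have w0 := psi1_neq0 hw.
have bz := bcont_cauchy hz; have bw := bcont_cauchy hw.
pose X v t : C := zeta t / (1 - v * zeta t).
set A := cint mu (X z); set B := cint mu (X w).
have E1 : cint mu (fun t => ccauchy z t * (ccauchy w t)^*%R) =
    cint mu (fun t => X z t * (X w t)^*%R) - A * B^*%R.
  have bz' : bcont (fun t => - B^*%R * X z t) by exact: bcontZ.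
  have bw' : bcont (fun t => - A * (X w t)^*%R) by apply: bcontZ; exact: bcontJ.
  have bc := bcont_cst (A * B^*%R).
  transitivity (cint mu (fun t => X z t * (X w t)^*%R +
      (- B^*%R * X z t + (- A * (X w t)^*%R + A * B^*%R)))).
    congr cint; apply/funext => t; rewrite /ccauchy conjD conjN.
    rewrite -/(X z t) -/(X w t) -/A -/B; ring.
  rewrite cintD; last 2 first.
  - by apply: bcontM => //; exact: bcontJ.
  - by apply: bcontD => //; exact: bcontD.
  rewrite (cintD bz' (bcontD bw' bc)) (cintD bw' bc).
  rewrite (cintZ _ bz) (cintZ _ (bcontJ bw)) cintJ // cint_cst -/A -/B; ring.
(* On the circle [zeta] times its conjugate is [1], which gives the pointwise identity
   [(1 - z w') X X' = 1 + z X + w' X'], primes marking conjugates. *)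
have E2 : (1 - z * w^*%R) * cint mu (fun t => X z t * (X w t)^*%R) =
    1 + z * A + w^*%R * B^*%R.
  rewrite -cintZ; last by apply: bcontM => //; exact: bcontJ.
  rewrite -[X in X + _ + _](cint_cst 1) -cintZ // -cintJ // -cintZ; last exact: bcontJ.
  rewrite -cintD; [|exact: bcont_cst|exact: bcontZ].
  rewrite -cintD; [|by apply: bcontD; [exact: bcont_cst|exact: bcontZ]|]; last first.
    by apply: bcontZ; exact: bcontJ.
  congr cint; apply/funext => t; rewrite /X.
  have h1 := sub1_zeta_neq0 t hz.
  have h2 : 1 - w^*%R * (zeta t)^*%R != 0.
    by rewrite -conjM -conj1 -conjN -conjD conjC_eq0 sub1_zeta_neq0.
  rewrite !conjE; have := zetaJ t.
  move: (zeta t) ((zeta t)^*%R) h1 h2 => u v h1 h2 uv.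
  have -> : u / (1 - z * u) * (v / (1 - w^*%R * v)) =
      (u * v) / ((1 - z * u) * (1 - w^*%R * v)).
    by field; rewrite h1 h2.
  rewrite uv.
  have -> : (1 - z * w^*%R) = (1 - z * w^*%R * (u * v)) by rewrite uv mulr1.
  by field; rewrite h1 h2.
(* What remains is [(1 + z A) (1 + w' B') - A B'], divided by [(1 + z A) (1 + w' B')]. *)
rewrite -mulrA E1 mulrBr E2 /hfun -/(X z) -/(X w) -/A -/B conjM.
have -> : 1 + psi mu z = 1 + z * A by rewrite psiE.
have Ew : 1 + psi mu w = 1 + w * B by rewrite psiE.
rewrite Ew in w0 *; rewrite psiE // -/(X z) -/A in z0; rewrite conjV.
have {}w0 : 1 + w^*%R * B^*%R != 0.
  by rewrite -conjM -conj1 -conjD conjC_eq0.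
rewrite conjD conj1 conjM.
by field; rewrite z0 w0.
Qed.

(** By [hfun_kernel] at the points [g (z i)], the form is an integral of kernel forms of [g], one
    for each angle [t], so it inherits positivity from [g]. *)
Lemma schur_hfun_comp (g : C -> C) : schur g -> (forall z, inD z -> inD (g z)) ->
  schur (fun z => hfun mu (g z)).
Proof.
move=> hg gD I z a hz.
pose D i := a i * (1 + psi mu (g (z i)))^-1.
pose Y i t := ccauchy (g (z i)) t.
have bY i : bcont (Y i) by apply: bcont_ccauchy; exact: gD.
pose G i j := (1 - g (z i) * (g (z j))^*%R) * szego (z i) (z j).
have -> : \sum_i \sum_j a i * (a j)^*%R *
   ((1 - hfun mu (g (z i)) * (hfun mu (g (z j)))^*%R) * szego (z i) (z j)) =
   \sum_i \sum_j cint mu (fun t =>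
      D i * (D j)^*%R * G i j * (Y i t * (Y j t)^*%R)).
  apply: eq_bigr => i _; apply: eq_bigr => j _.
  rewrite cintZ; last by apply: bcontM => //; exact: bcontJ.
  rewrite hfun_kernel; [|exact: gD|exact: gD].
  by rewrite /D /G conjM -/(Y i) -/(Y j); ring.
have bG i j : bcont (fun t => D i * (D j)^*%R * G i j * (Y i t * (Y j t)^*%R)).
  by apply: bcontZ; apply: bcontM => //; exact: bcontJ.
under eq_bigr do rewrite -cint_sum //.
rewrite -cint_sum; last by move=> i; exact: bcont_sum.
(* For fixed [t] the integrand is the kernel form of [g] with coefficients [D i * Y i t]. *)
apply: cint_ge0 => t; have := hg I z (fun i => D i * Y i t) hz.
congr (0 <= _); apply: eq_bigr => i _; apply: eq_bigr => j _.
by rewrite conjM /G; ring.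
Qed.

Lemma schur_hfun : schur (hfun mu).
Proof. by apply: (@schur_hfun_comp id) => //; exact: schur_id. Qed.

Lemma normc_eta z : inD z -> normc (Defs.eta mu z) <= normc z.
Proof.
move=> hz; rewrite eta_hfun // normcM ler_piMr ?normc_ge0 //.
exact: schur_le1 schur_hfun hz.
Qed.

Lemma inD_eta z : inD z -> inD (Defs.eta mu z).
Proof.
move=> hz; apply/inDE; apply: le_lt_trans (normc_eta hz) _; exact/inDE.
Qed.

End Integral.
End EtaTransform.

(** * Limits of bounded sequences along an ultrafilter *)

Section Ultralimits.
Variable R : realType.
Local Notation C := R[i].

Lemma ex_ultra_oo : exists U : set_system nat, UltraFilter U /\ \oo `<=` U.
Proof. exact: ultraFilterLemma. Qed.

Section Ultrafilter.
Context (U : set_system nat) {UU : UltraFilter U}.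

(** Compactness of [[-M, M]] yields a cluster point, and an ultrafilter converges to its cluster
    points. *)
Lemma ultra_cvg (u : nat -> R) (M : R) :
  (forall k, `|u k| <= M) -> exists l : R, u @ U --> l.
Proof.
move=> uM; have Up := @ultra_proper _ _ UU.
have [l [_ clu]] := @segment_compact R (- M) M (u @ U) _
  (@filterE _ U _ [set k | `[- M, M]%classic (u k)] (fun k => ltac:(
     by rewrite /= in_itv /= -ler_norml; exact: uM))).
exists l => V Vl; rewrite /= /nbhs /=.
have [//|UV] := in_ultra_setVsetC (u @^-1` V) UU.
by have [x [/=]] := clu (~` V) V UV Vl.
Qed.

Lemma ultra_cvgC (u : nat -> C) (M : R) :
  (forall k, normc (u k) <= M) -> exists l : C, cvgC U u l.
Proof.
move=> uM.
have [a ua] : exists a : R, (fun k => complex.Re (u k)) @ U --> a.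
  by apply: (ultra_cvg (M := M)) => k; rewrite (le_trans (normr_Re_le _)).
have [b ub] : exists b : R, (fun k => complex.Im (u k)) @ U --> b.
  by apply: (ultra_cvg (M := M)) => k; rewrite (le_trans (normr_Im_le _)).
by exists (a +i* b).
Qed.

Lemma ultra_cvgC_oo (u : nat -> C) l : \oo `<=` U -> cvgC \oo u l -> cvgC U u l.
Proof. by move=> oU [u1 u2]; split => V hV; apply: oU; [exact: u1|exact: u2]. Qed.

End Ultrafilter.
End Ultralimits.

(** * Schur roots of [hfun mu] under infinite divisibility *)

Section Roots.
Variable R : realType.
Local Notation C := R[i].
Implicit Types (z : C) (mu nu : probability (measurableTypeR R) R).

Lemma eta0 mu : Defs.eta mu 0 = 0 :> C.
Proof. by rewrite eta_hfun ?mul0r //; exact: inD0. Qed.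

Lemma iter_eta0 mu k : iter k (Defs.eta mu) 0 = 0 :> C.
Proof. by elim: k => //= k ->; rewrite eta0. Qed.

Lemma inD_iter_eta mu k z : inD z -> inD (iter k (Defs.eta mu) z).
Proof. by move=> hz; elim: k => //= k; exact: inD_eta. Qed.

(** Since [eta w = w * hfun w], each iterate is the previous one times a Schur factor. *)
Lemma schur_iter_eta mu k : schur (iter k (@Defs.eta R mu)).
Proof.
elim: k => [|k IH]; first exact: schur_id.
have := schur_mul IH (schur_hfun_comp mu IH (fun z => @inD_iter_eta mu k z)).
apply: eq_schur => z hz /=; rewrite eta_hfun //; exact: inD_iter_eta.
Qed.

(** Exponents are successors because [cm_pow] gives [0] and [1] the same value. *)
Lemma cm_powE mu1 nu1 N z : inD z ->
  (cm_pow mu1 nu1 N.+1).1 z =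
    z * \prod_(k < N.+1) hfun mu1 (iter k (Defs.eta nu1) z) /\
  (cm_pow mu1 nu1 N.+1).2 z = iter N.+1 (Defs.eta nu1) z.
Proof.
move=> hz; elim: N => [|N [IH1 IH2]].
  by split => //; rewrite big_ord_recr big_ord0 /= mul1r eta_hfun.
have E : cm_pow mu1 nu1 N.+2 = let p := cm_pow mu1 nu1 N.+1 in
  (fun z => p.1 z * hfun mu1 (p.2 z), fun z => Defs.eta nu1 (p.2 z)) by [].
rewrite E; cbv zeta; cbn [fst snd]; rewrite IH1 IH2; split => //.
by rewrite [in RHS]big_ord_recr -mulrA.
Qed.

(** The factors are [hfun mu1] composed with the iterates of [eta nu1]; these fix [0], whence the
    common value there. *)
Lemma ID_cm_factors mu nu N : ID_cm mu nu -> (2 <= N)%N ->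
  exists (w : nat -> C -> C) (c : C), [/\ forall k, schur (w k),
    forall k, w k 0 = c &
    forall z, inD z -> hfun mu z = \prod_(k < N) w k z].
Proof.
move=> ID; case: N => // N N2; have [mu1 [nu1 [_ [_ H]]]] := ID _ N2.
pose w k z := hfun mu1 (iter k (Defs.eta nu1) z).
have sw k : schur (w k).
  by apply: schur_hfun_comp; [exact: schur_iter_eta|exact: inD_iter_eta].
exists w, (hfun mu1 0); split => // [k|]; first by rewrite /w iter_eta0.
have E z : inD z -> z != 0 -> hfun mu z = \prod_(k < N.+1) w k z.
  move=> hz z0; have [+ _] := H z hz.
  by rewrite eta_hfun // (cm_powE _ _ _ hz).1 => /(mulfI z0).
move=> z hz; have [->|] := eqVneq z 0; last exact: E.
(* The factor [z] cannot be cancelled at [0], where continuity takes over. *)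
exact: schur_eq0 (schur_hfun mu) (schur_prod (index_enum 'I_N.+1) sw) E.
Qed.

(** Telescoping: the factors are exchanged one at a time, the others having modulus at most [1]. *)
Lemma prod_sub_le N (a b : nat -> C) :
  (forall k, normc (a k) <= 1) -> (forall k, normc (b k) <= 1) ->
  normc (\prod_(k < N) a k - \prod_(k < N) b k) <=
  \sum_(k < N) normc (a k - b k).
Proof.
move=> a1 b1; elim: N => [|N IH]; first by rewrite !big_ord0 subrr normc0.
rewrite !big_ord_recr /=; set A := \prod_(k < N) a k; set B := \prod_(k < N) b k.
have -> : A * a N - B * b N = (A - B) * a N + B * (a N - b N) by ring.
rewrite (le_trans (normcD _ _)) // !normcM lerD //.
  by rewrite (le_trans _ IH) // ler_piMr ?normc_ge0.
rewrite ler_piMl ?normc_ge0 // normc_prod.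
by apply: prodr_ile1 => k _; rewrite normc_ge0 b1.
Qed.

(** The error at [n + 1] is [1 - y] times the error at [n], plus [n y^2]. *)
Lemma bernoulli_sub_le (y : C) n : normc (1 - y) <= 1 ->
  normc ((1 - y) ^+ n - (1 - n%:R * y)) <= (n%:R * normc y) ^+ 2.
Proof.
move=> y1; elim: n => [|n IH].
  by rewrite expr0 mul0r subr0 subrr normc0 sqr_ge0.
have -> : (1 - y) ^+ n.+1 - (1 - n.+1%:R * y) =
    (1 - y) * ((1 - y) ^+ n - (1 - n%:R * y)) + n%:R * y ^+ 2.
  by rewrite exprS -natr1; ring.
rewrite (le_trans (normcD _ _)) //.
apply: le_trans (_ : (n%:R * normc y) ^+ 2 + n%:R * normc y ^+ 2 <= _).
  rewrite lerD // !normcM ?normcX.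
    by rewrite (le_trans _ IH) // ler_piMl ?normc_ge0.
  have -> : n%:R = (n%:R : R)%:C by rewrite rmorph_nat.
  by rewrite normc_real normr_nat.
rewrite -natr1; have n0 : 0 <= n%:R :> R by exact: ler0n.
have := sqr_ge0 (normc y); nra.
Qed.

(** [G] is the product of the functions [1 - (1 - u w_k) / n], where the rotation [u] makes the
    common value at [0] equal to [|c| = 1 - d]. The [n]-th power of each factor differs from [u w_k]
    by [O(d^2)], and [N d] stays bounded. *)
Lemma schur_approx_root (f : C -> C) (n N : nat) (w : nat -> C -> C) (c : C) :
  (0 < n)%N -> (0 < N)%N -> f 0 != 0 ->
  (forall k, schur (w k)) -> (forall k, w k 0 = c) ->
  (forall z, inD z -> f z = \prod_(k < N) w k z) ->
  exists2 G, schur G & forall z, inD z ->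
    normc (G z ^+ n - f z * ((normc (f 0))%:C / f 0)) <=
    (5 / (1 - normc z ^+ 2) * ((normc (f 0))^-1 - 1)) ^+ 2 / N%:R.
Proof.
move=> n0 N0 f0 sw w0 fE; set m := normc (f 0).
have m0 : 0 < m by rewrite lt_neqAle normc_ge0 eq_sym normc_eq0 f0.
have fc : f 0 = c ^+ N.
  rewrite fE; last exact: inD0.
  by under eq_bigr do rewrite w0; rewrite big_const card_ord iter_mulr_1.
have mc : m = normc c ^+ N by rewrite /m fc normcX.
have c0 : c != 0 by apply: contraNneq f0; rewrite fc => ->; rewrite expr0n eqn0Ngt N0.
have nc0 : 0 < normc c by rewrite lt_neqAle normc_ge0 eq_sym normc_eq0 c0.
have c1 : normc c <= 1 by rewrite -(w0 0) schur_le1 //; exact: inD0.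
pose u := (normc c)%:C / c; pose d := 1 - normc c.
have u1 : normc u = 1.
  by rewrite /u normcM normcV normc_real gtr0_norm // mulfV // gt_eqF.
have uN : u ^+ N = m%:C / f 0 by rewrite /u expr_div_n -realCX -mc -fc.
have d01 : 0 <= d <= 1 by rewrite subr_ge0 c1 gerBl normc_ge0.
(* Since [m = (1 - d)^N], this is the inequality [(1 + N d) (1 - d)^N <= 1]. *)
have Nd : N%:R * d <= m^-1 - 1.
  rewrite lerBrDl -[leRHS]mul1r ler_pdivlMr // mc.
  rewrite -[X in X ^+ N](subKr 1) -/d; elim: (N) => [|K IH].
    by rewrite mul0r addr0 mulr1.
  move/andP: d01 => [d0 d1]; rewrite exprS -natr1.
  have K0 : 0 <= K%:R :> R by exact: ler0n.
  have dK : 0 <= (1 - d) ^+ K by rewrite exprn_ge0 // subr_ge0.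
  apply: le_trans IH; rewrite mulrA ler_wpM2r //; nra.
pose v k z := (n%:R^-1)%:C * (u * w k z) + (1 - n%:R^-1)%:C * 1.
have nV : 0 <= (n%:R^-1 : R) <= 1.
  by rewrite invr_ge0 ler0n invf_le1 ?ltr0n // ler1n n0.
have suw k : schur (fun z => u * w k z).
  by apply: schur_mul => //; apply: schur_cst; rewrite u1.
have sv k : schur (v k).
  by apply: (schur_conv (h := fun=> 1)) => //; apply: schur_cst; rewrite normc1.
exists (fun z => \prod_(k < N) v k z); first exact: schur_prod.
move=> z hz.
have -> : f z * (m%:C / f 0) = \prod_(k < N) (u * w k z).
  by rewrite big_split /= big_const card_ord iter_mulr_1 uN mulrC (fE z hz).
rewrite -prodrXl.
have H k : normc (v k z ^+ n - u * w k z) <= (5 / (1 - normc z ^+ 2) * d) ^+ 2.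
  pose y := (n%:R^-1)%:C * (1 - u * w k z).
  have nC : (n%:R : C) = (n%:R : R)%:C by rewrite rmorph_nat.
  have n1 : (n%:R : R) != 0 by rewrite pnatr_eq0 -lt0n.
  have vy : v k z = 1 - y by rewrite /v /y realCD realCN; ring.
  have ny : n%:R * y = 1 - u * w k z.
    by rewrite /y nC mulrA -realCM mulfV // mul1r.
  have -> : v k z ^+ n - u * w k z = (1 - y) ^+ n - (1 - n%:R * y).
    by rewrite vy ny; ring.
  apply: le_trans (bernoulli_sub_le _ _) _; first by rewrite -vy schur_le1.
  have -> : n%:R * normc y = normc (1 - u * w k z).
    by rewrite -ny normcM nC normc_real normr_nat.
  rewrite lerXn2r ?nnegrE ?normc_ge0 //.
    rewrite mulr_ge0 // ?divr_ge0 //; first by rewrite ltW // normc_lt1_sqr.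
    by case/andP: d01.
  apply: (schur_harnack (suw k)) => //.
  by rewrite w0 /u mulfVK // /d subKr.
have v1 k : normc (v k z ^+ n) <= 1.
  by rewrite normcX expr_le1 ?normc_ge0 ?schur_le1.
have w1 k : normc (u * w k z) <= 1 by exact: schur_le1 (suw k) hz.
apply: le_trans (prod_sub_le N v1 w1) _.
have : \sum_(k < N) normc (v k z ^+ n - u * w k z) <=
    \sum_(k < N) (5 / (1 - normc z ^+ 2) * d) ^+ 2.
  by apply: ler_sum => k _; exact: H.
move=> /le_trans; apply; rewrite sumr_const card_ord -[_ *+ N]mulr_natl.
have N0' : (0 : R) < N%:R by rewrite ltr0n.
set q := 5 / (1 - normc z ^+ 2).
have q0 : 0 <= q by rewrite divr_ge0 // ltW // normc_lt1_sqr.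
have d0 : 0 <= d by case/andP: d01.
rewrite ler_pdivlMr //.
(* The [N] errors [(q d)^2] add up to [(q N d)^2 / N]. *)
have -> : N%:R * (q * d) ^+ 2 * N%:R = (q * (N%:R * d)) ^+ 2 by ring.
have Nd0 : 0 <= N%:R * d by rewrite mulr_ge0 ?ler0n.
rewrite lerXn2r ?nnegrE ?ler_wpM2l // mulr_ge0 //.
exact: le_trans Nd0 Nd.
Qed.

Lemma ID_cm_root mu nu n : ID_cm mu nu -> (0 < n)%N ->
  exists2 g, schur g & forall z, inD z -> g z ^+ n = hfun mu z.
Proof.
move=> ID n0; have [f0|f0] := eqVneq (hfun mu 0) 0.
  exists (fun=> 0); first by apply: schur_cst; rewrite normc0.
  move=> z hz; rewrite expr0n eqn0Ngt n0; apply/esym/eqP.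
  rewrite -normc_eq0 eq_le normc_ge0 andbT.
  have z01 : 0 <= normc z < 1 by rewrite normc_ge0; apply/inDE.
  have /(@cvgr_dist_le _ _ _ _ _ _) := geometric_cvg0 1 z01.
  move=> H; apply/ler_addgt0Pl => e e0; rewrite addr0.
  (* Infinite divisibility provides factorizations for [N >= 2] only, hence the maximum. *)
  have [K _ HK] := H _ e0; pose N := (maxn K 2).
  have [w [c [sw w0 fE]]] := ID_cm_factors ID (leq_maxr K 2).
  have c0 : c = 0.
    have : c ^+ N = 0.
      rewrite -f0 fE; last exact: inD0.
      by under eq_bigr do rewrite w0; rewrite big_const card_ord iter_mulr_1.
    by move/eqP; rewrite expf_eq0 => /andP[_ /eqP].
  have HN : `|0 - 1 * normc z ^+ N| <= e := HK N (leq_maxl K 2).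
  rewrite sub0r normrN mul1r ger0_norm ?exprn_ge0 ?normc_ge0 // in HN.
  apply: le_trans HN.
  rewrite fE // normc_prod -[X in _ ^+ X]card_ord -prodr_const ler_prod // => k _.
  by rewrite normc_ge0 schur_schwarz // w0.
have H k : exists G : C -> C, schur G /\ forall z, inD z ->
    normc (G z ^+ n - hfun mu z * ((normc (hfun mu 0))%:C / hfun mu 0)) <=
    (5 / (1 - normc z ^+ 2) * ((normc (hfun mu 0))^-1 - 1)) ^+ 2 / k.+2%:R.
  have [w [c [sw w0 fE]]] := @ID_cm_factors mu nu k.+2 ID isT.
  by have [G sG HG] := @schur_approx_root _ n k.+2 w c n0 isT f0 sw w0 fE; exists G.
have [G HG] := choice H.
have [U [UU oU]] := ex_ultra_oo; have Up := @ultra_proper _ _ UU.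
(* Outside the disc any value will do; the implication lets [choice] return a total function. *)
have Hg z : exists l, inD z -> cvgC U (fun k => G k z) l.
  have [hz|hz] := pselect (inD z); last by exists 0.
  have [l hl] : exists l, cvgC U (fun k => G k z) l.
    by apply: (ultra_cvgC (M := 1)) => k; exact: schur_le1 (HG k).1 hz.
  by exists l.
have [g Hg'] := choice Hg.
have sg : schur g by apply: (schur_cvg (F := U)) Hg' => k; exact: (HG k).1.
set gam := (normc (hfun mu 0))%:C / hfun mu 0.
have E z : inD z -> g z ^+ n = hfun mu z * gam.
  move=> hz; apply: (cvgC_unique (F := U)); first exact: cvgCX (Hg' z hz).
  apply: ultra_cvgC_oo oU _; apply: cvgC_bound (fun k => (HG k).2 z hz) _.
  rewrite -[X in _ --> X](mulr0 ((5 / (1 - normc z ^+ 2) * ((normc (hfun mu 0))^-1 - 1)) ^+ 2)).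
  apply: cvgM; first exact: cvg_cst.
  have := @cvg_harmonic R; rewrite -cvg_shiftS; exact.
(* The limit is a root of [hfun mu] rotated by the unimodular constant [gam]; multiplying by an
   [n]-th root of [gam^-1] undoes the rotation. *)
have [b bn] : exists b : C, b ^+ n = gam^-1.
  by exists (n.-root gam^-1)%R; rewrite rootCK.
have gam1 : normc gam = 1.
  have m0 : 0 < normc (hfun mu 0) by rewrite lt_neqAle normc_ge0 eq_sym normc_eq0 f0.
  by rewrite /gam normcM normcV normc_real gtr0_norm // mulfV // gt_eqF.
have b1 : normc b = 1.
  have : normc b ^+ n == 1 by rewrite -normcX bn normcV gam1 invr1.
  by rewrite pexpr_eq1 ?normc_ge0 // => /eqP.
exists (fun z => b * g z); first by apply: schur_mul sg; apply: schur_cst; rewrite b1.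
move=> z hz; rewrite exprMn bn E // mulrC mulfK //.
by rewrite -normc_eq0 gam1 oner_eq0.
Qed.

End Roots.

(** * Step functions and quantile functions under the uniform law *)

Section Quantile.
Variable R : realType.
Local Notation C := R[i].
Local Notation Re := complex.Re.
Local Notation Im := complex.Im.
Local Notation mT := (measurableTypeR R).

Definition unif01 : probability mT R := uniform_prob (@ltr01 R).

Lemma unif01_itv (a b : R) : 0 <= a -> a <= b -> b <= 1 ->
  unif01 `[a, b[%classic = (b - a)%:E.
Proof.
move=> a0 ab b1; rewrite /unif01 /= /uniform_prob.
rewrite (eq_integral (fun=> 1%:E)); last first.
  move=> x /set_mem; rewrite /= in_itv /= => /andP[ax xb].
  rewrite /uniform_pdf (le_trans a0 ax) (le_trans (ltW xb) b1) /=.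
  by rewrite subr0 invr1.
rewrite integral_cst //= mul1e lebesgue_measure_itv /= lte_fin.
have [_|ba] := ltP a b; first by rewrite EFinB.
by have /eqP -> : a == b; rewrite ?eq_le ?ab ?ba // subrr.
Qed.

Section Pieces.
Variables (P : probability mT R) (f : R -> R) (M : R).
Hypotheses (mf : measurable_fun [set: mT] f) (fM : forall t, `|f t| <= M).

Lemma integrable_piece (B : set mT) : measurable B ->
  P.-integrable B (EFin \o f).
Proof.
by move=> mB; apply: integrableS (bounded_integrable _ mf fM).
Qed.

Lemma Rintegral_piece (B : set mT) (c e : R) : measurable B ->
  (forall t, B t -> `|f t - c| <= e) ->
  `|\int[P]_(t in B) f t - c * fine (P B)| <= e * fine (P B).
Proof.
move=> mB H; have iB := integrable_piece mB.
have ic (x : R) : P.-integrable B (EFin \o (fun=> x)).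
  apply: integrableS (bounded_integrable (M := `|x|) _ _ _) => //.
rewrite -!Rintegral_cst // -RintegralB //.
have iD : P.-integrable B (EFin \o (fun t => f t - c)).
  rewrite (_ : _ \o _ = (EFin \o f) \- (EFin \o (fun=> c)))%E //.
  exact: integrableB.
apply: le_trans (le_normr_Rintegral _ iD) _ => //.
apply: le_Rintegral => //.
by have := integrable_abse iD; rewrite (_ : _ \o _ = EFin \o (fun t => `|f t - c|)).
Qed.

Lemma Rintegral_step (p c e : nat -> R) (N : nat) :
  (forall i, p i <= p i.+1) ->
  (forall i, (i < N)%N -> forall t, p i <= t < p i.+1 -> `|f t - c i| <= e i) ->
  `|\int[P]_(t in `[p 0%N, p N[%classic) f t -
    \sum_(i < N) c i * fine (P `[p i, p i.+1[%classic)| <=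
  \sum_(i < N) e i * fine (P `[p i, p i.+1[%classic).
Proof.
move=> pS; elim: N => [|N IH] H.
  by rewrite set_itv_ge ?bnd_simp ?lexx // Rintegral_set0 !big_ord0 subrr normr0.
have p0N : p 0 <= p N by elim: (N) => // k; move/le_trans; apply.
have -> : `[p 0%N, p N.+1[%classic = `[p 0%N, p N[%classic `|` `[p N, p N.+1[%classic.
  by apply: itv_bndbnd_setU; rewrite bnd_simp.
rewrite Rintegral_setU //; last 2 first.
- by apply: integrable_piece; apply: measurableU.
- apply/disj_setPS => t [/=]; rewrite !in_itv /= => /andP[_ h1] /andP[h2 _].
  by have := lt_le_trans h1 h2; rewrite ltxx.
rewrite !big_ord_recr /=.
have {}IH := IH (fun i iN => H i (ltnW iN)).
have h2 := @Rintegral_piece `[p N, p N.+1[%classic (c N) (e N) _ _.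
rewrite opprD addrACA (le_trans (ler_normD _ _)) // lerD //.
by apply: h2 => // t; rewrite /= in_itv; exact: H.
Qed.

End Pieces.

(** With oscillations for [e] this bounds the error of Riemann sums; with [e = 0] it integrates step
    functions exactly. *)
Lemma unif01_step (f : R -> R) (M : R) (p c e : nat -> R) (N : nat) :
  measurable_fun [set: mT] f -> (forall t, `|f t| <= M) ->
  (forall i, p i <= p i.+1) -> p 0 = 0 -> p N = 1 ->
  (forall i, (i < N)%N -> forall t, p i <= t < p i.+1 -> `|f t - c i| <= e i) ->
  `|\int[unif01]_(t in setT) f t - \sum_(i < N) c i * (p i.+1 - p i)| <=
  \sum_(i < N) e i * (p i.+1 - p i).
Proof.
move=> mf fM pS p0 pN H; have := Rintegral_step unif01 mf fM pS H.
have pm i j : (i <= j)%N -> p i <= p j.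
  by move=> ij; apply: (homo_leq (@lexx _ _) (@le_trans _ _)).
have E i : (i < N)%N -> fine (unif01 `[p i, p i.+1[%classic) = p i.+1 - p i.
  by move=> iN; rewrite unif01_itv // -?p0 -?pN ?pm.
under eq_bigr do rewrite E //.
under [X in _ <= X -> _]eq_bigr do rewrite E //.
suff -> : \int[unif01]_(t in setT) f t =
    \int[unif01]_(t in `[p 0%N, p N[%classic) f t by [].
rewrite p0 pN; set D := `[0, 1[%classic.
have mD : measurable (D : set mT) by exact: measurable_itv.
rewrite -[in LHS](setUv D) Rintegral_setU //; last 3 first.
- exact: measurableC.
- by apply: (integrable_piece _ mf fM); rewrite setUv.
- by apply/disj_setPS => t [].
(* The complement of [[0, 1[] is null, so its share of the integral vanishes. *)
have PD : unif01 (~` D) = 0%E.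
  rewrite probability_setC // unif01_itv // subr0 -EFinB subrr //.
have := Rintegral_piece unif01 mf fM (c := 0) (e := M) (measurableC mD) _.
rewrite PD /= !mulr0 subr0 => h.
have /eqP : `|\int[unif01]_(t in ~` D) f t| == 0.
  by rewrite eq_le normr_ge0 andbT h // => t _; rewrite subr0.
by move/normr0_eq0 ->; rewrite addr0.
Qed.

(** The closed range makes the class stable under pointwise limits; [2 * pi] and [0] are the same
    point of the circle. *)
Definition quantile (q : R -> R) :=
  {homo q : x y / x <= y} /\ forall x, 0 <= q x <= 2 * pi.

Lemma quantile_measurable q : quantile q -> measurable_fun [set: mT] q.
Proof.
move=> [hq _]; apply: nondecreasing_measurable => // x y _ _; exact: hq.
Qed.

(** By monotonicity the error on a cell is at most [L] times the increment of [q], and the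
    increments telescope to at most [2 * pi]; the bound is uniform in [q]. *)
Lemma quantile_riemann (f : R -> R) (B L : R) (q : R -> R) (M : nat) :
  continuous f -> (forall t, `|f t| <= B) ->
  (forall s t, `|f s - f t| <= L * `|s - t|) -> 0 <= L ->
  quantile q -> (0 < M)%N ->
  `|\int[unif01]_(t in setT) f (q t) - (\sum_(l < M) f (q (l%:R / M%:R))) / M%:R|
  <= L * (2 * pi) / M%:R.
Proof.
move=> cf fB fL L0 hq M0; have [qm q01] := hq.
have M0' : 0 < M%:R :> R by rewrite ltr0n.
pose p (l : nat) : R := l%:R / M%:R.
have pS l : p l <= p l.+1 by rewrite ler_pM2r ?invr_gt0 // ler_nat.
have pd l : p l.+1 - p l = M%:R^-1 by rewrite /p -mulrBl -natr1 addrAC subrr add0r mul1r.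
have mfq : measurable_fun [set: mT] (fun t => f (q t)).
  apply: measurableT_comp (quantile_measurable hq).
  exact: continuous_measurable_fun.
have := @unif01_step _ B p (fun l => f (q (p l)))
  (fun l => L * (q (p l.+1) - q (p l))) M mfq (fun t => fB _) pS.
rewrite {1}/p mul0r {1}/p divff ?gt_eqF // => /(_ erefl erefl).
have E (a : nat -> R) : \sum_(i < M) a i * (p i.+1 - p i) =
    (\sum_(i < M) a i) / M%:R.
  by rewrite mulr_suml; apply: eq_bigr => i _; rewrite pd.
rewrite (E (fun i => f (q (p i)))) (E (fun l => L * (q (p l.+1) - q (p l)))).
rewrite -mulr_sumr => H.
apply: le_trans (H _) _ => [l lM t /andP[h1 h2]|].
  apply: le_trans (fL _ _) _; rewrite ler_wpM2l //.
  have a1 := qm _ _ h1; have a2 := qm _ _ (ltW h2).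
  by rewrite ger0_norm ?subr_ge0 // lerD2r.
rewrite ler_wpM2r ?invr_ge0 ?(ltW M0') // ler_wpM2l //.
rewrite (_ : \sum_(i < M) _ = q (p M) - q (p 0)); last first.
  elim: (M) => [|K IH]; first by rewrite big_ord0 subrr.
  by rewrite big_ord_recr /= IH; ring.
have /andP[_ a1] := q01 (p M); have /andP[a2 _] := q01 (p 0); lra.
Qed.

Lemma trig_lipschitz (f df : R -> R) : (forall x : R, is_derive x 1 f (df x)) ->
  continuous f -> (forall x, `|df x| <= 1) ->
  forall s t, `|f s - f t| <= `|s - t|.
Proof.
move=> hd cf df1; suff H s t : s <= t -> `|f s - f t| <= `|s - t|.
  move=> s t; have [|/ltW] := leP s t; first exact: H.
  by move/H; rewrite distrC [in leRHS]distrC.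
move=> st; have [|c _ E] := @MVT_segment _ f df s t st (fun x _ => hd x).
  exact: continuous_subspaceT.
rewrite distrC E normrM [in leRHS]distrC ler_piMl //.
Qed.

Lemma normc_zetaB s t : normc (zeta s - zeta t) <= 2 * `|s - t| :> R.
Proof.
rewrite (le_trans (normc_le_ReIm _)) // mulr_natl mulr2n lerD //.
  have sin1 x : `|- sin x| <= 1 :> R by rewrite normrN sin_max.
  have := trig_lipschitz (@is_derive_cos R) (@continuous_cos R) sin1 s t.
  by rewrite cReD cReN.
have := trig_lipschitz (@is_derive_sin R) (@continuous_sin R) (@cos_max R) s t.
by rewrite cImD cImN.
Qed.

(** The mean of this kernel is [1 + psi mu z], by [psi1E]. *)
Definition poisson (z : C) (t : R) : C := (1 - z * zeta t)^-1.

(** A Lipschitz constant of [poisson z]: the [2] comes from [normc_zetaB], each power of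
    [1 - normc z] from one denominator. *)
Definition plip (z : C) : R := 2 / (1 - normc z) ^+ 2.

Lemma plip_ge0 z : 0 <= plip z.
Proof. by rewrite divr_ge0 ?sqr_ge0. Qed.

Lemma poisson_lipschitz z s t : inD z ->
  normc (poisson z s - poisson z t) <= plip z * `|s - t|.
Proof.
move=> hz; have h1 := sub1_zeta_neq0 s hz; have h2 := sub1_zeta_neq0 t hz.
have z1 : 0 < 1 - normc z by rewrite subr_gt0; apply/inDE.
have -> : poisson z s - poisson z t =
    z * (zeta s - zeta t) * ((1 - z * zeta s)^-1 * (1 - z * zeta t)^-1).
  by rewrite /poisson; field; rewrite h1 h2.
have V t' : (normc (1 - z * zeta t'))^-1 <= (1 - normc z)^-1.
  rewrite lef_pV2 ?posrE ?sub1_zeta_ge //.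
  exact: lt_le_trans z1 (sub1_zeta_ge _ _).
rewrite !normcM !normcV.
have -> : plip z * `|s - t| =
    1 * (2 * `|s - t|) * ((1 - normc z)^-1 * (1 - normc z)^-1).
  by rewrite /plip expr2 invfM; ring.
have z1' : normc z <= 1 by rewrite ltW // -subr_gt0.
by rewrite !ler_pM ?mulr_ge0 ?invr_ge0 ?normc_ge0 ?normc_zetaB.
Qed.

End Quantile.

(** * Functions represented by a quantile function *)

Section Representation.
Variable R : realType.
Local Notation C := R[i].
Local Notation Re := complex.Re.
Local Notation Im := complex.Im.
Local Notation mT := (measurableTypeR R).
Implicit Types (z : C) (Phi : C -> C).

Lemma cRe_sum (I : Type) (s : seq I) (P : pred I) (f : I -> C) :
  Re (\sum_(i <- s | P i) f i) = \sum_(i <- s | P i) Re (f i).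
Proof. by elim/big_rec2: _ => // i x y _ <-; rewrite cReD. Qed.

Lemma cIm_sum (I : Type) (s : seq I) (P : pred I) (f : I -> C) :
  Im (\sum_(i <- s | P i) f i) = \sum_(i <- s | P i) Im (f i).
Proof. by elim/big_rec2: _ => // i x y _ <-; rewrite cImD. Qed.

Lemma cRe_scale (x : R) z : Re (x%:C * z) = x * Re z.
Proof. by rewrite cReM /= mul0r subr0. Qed.

Lemma cIm_scale (x : R) z : Im (x%:C * z) = x * Im z.
Proof. by rewrite cImM /= mul0r addr0. Qed.

Lemma cvgC_normc_le (F : set_system nat) {FF : ProperFilter F} (u : nat -> C) l
  (c : R) : 0 <= c -> (forall k, normc (u k) <= c) -> cvgC F u l -> normc l <= c.
Proof.
move=> c0 uc ul; rewrite -ler_sqr ?nnegrE ?normc_ge0 // -subr_ge0 -ler0c.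
rewrite realCD realCN normc_sqr.
apply: (@cvgC_ge0 R F FF (fun k => (c ^+ 2)%:C - u k * (u k)^*%R)).
  move=> k; rewrite -normc_sqr -realCN -realCD ler0c subr_ge0.
  by rewrite lerXn2r ?nnegrE ?normc_ge0.
apply: cvgCB; first exact: cvgC_cst.
by apply: cvgCM => //; exact: cvgCJ.
Qed.

Lemma cvgC_poisson (F : set_system nat) {FF : ProperFilter F} z
    (u : nat -> R) (l : R) : inD z -> u @ F --> l ->
  cvgC F (fun k => poisson z (u k)) (poisson z l).
Proof.
move=> hz ul; apply: cvgCV; first exact: sub1_zeta_neq0.
apply: cvgCB; first exact: cvgC_cst.
apply: cvgCM; first exact: cvgC_cst.
split => /=.
  by apply: (@continuous_cvg _ _ _ F); [exact: continuous_cos|].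
by apply: (@continuous_cvg _ _ _ F); [exact: continuous_sin|].
Qed.

Definition riemann z (q : R -> R) (M : nat) : C :=
  (M%:R^-1)%:C * \sum_(l < M) poisson z (q (l%:R / M%:R)).

Lemma poisson_component (g : C -> R) z : inD z ->
  (forall u v, `|g u - g v| <= normc (u - v)) ->
  forall s t, `|g (poisson z s) - g (poisson z t)| <= plip z * `|s - t|.
Proof.
by move=> hz hg s t; apply: le_trans (hg _ _) _; exact: poisson_lipschitz.
Qed.

Lemma cint_riemann z q M : inD z -> quantile q -> (0 < M)%N ->
  normc (cint (unif01 R) (fun t => poisson z (q t)) - riemann z q M) <=
  2 * (plip z * (2 * pi)) / M%:R.
Proof.
move=> hz hq M0; have [c1 c2 [B hB]] := bcont_poisson hz.
rewrite (le_trans (normc_le_ReIm _)) // -mulrA mulr_natl mulr2n lerD //.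
  rewrite cReD cReN cRe_scale cRe_sum [_^-1 * _]mulrC.
  apply: (quantile_riemann (f := fun t => Re (poisson z t)) (B := B)) => //.
  - by move=> t; exact: le_trans (normr_Re_le _) (hB t).
  - apply: poisson_component => // u v; rewrite -cReN -cReD; exact: normr_Re_le.
  - exact: plip_ge0.
rewrite cImD cImN cIm_scale cIm_sum [_^-1 * _]mulrC.
apply: (quantile_riemann (f := fun t => Im (poisson z t)) (B := B)) => //.
- by move=> t; exact: le_trans (normr_Im_le _) (hB t).
- apply: poisson_component => // u v; rewrite -cImN -cImD; exact: normr_Im_le.
- exact: plip_ge0.
Qed.

(* [Phi] is [z |-> E[1 / (1 - z zeta)]] for the law with quantile function [q]. *)
Definition rep Phi := exists2 q, quantile q & forall z, inD z ->
  Phi z = cint (unif01 R) (fun t => poisson z (q t)).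

(* Monotonicity makes the Riemann sums converge uniformly over all quantile
   functions, so an ultralimit may be taken inside the integral. *)
Lemma rep_cvg (Phi_ : nat -> C -> C) Phi : (forall k, rep (Phi_ k)) ->
  (forall z, inD z -> cvgC \oo (fun k => Phi_ k z) (Phi z)) -> rep Phi.
Proof.
move=> hrep hcvg.
have /choice[q_ hq] : forall k, exists q, quantile q /\ forall z, inD z ->
    Phi_ k z = cint (unif01 R) (fun t => poisson z (q t)).
  by move=> k; have [q] := hrep k; exists q.
have [U [UU oU]] := ex_ultra_oo; have Up := @ultra_proper _ _ UU.
have pi0 : 0 <= 2 * pi :> R by rewrite mulr_ge0 // pi_ge0.
have /choice[q hqq] : forall x, exists l : R, (fun k => q_ k x) @ U --> l.
  move=> x; apply: (ultra_cvg (M := 2 * pi)) => k.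
  by have /andP[h1 h2] := (hq k).1.2 x; rewrite ger0_norm.
have hquant : quantile q.
  split.
    move=> x y xy; apply: ler_cvg_to (hqq x) (hqq y) _.
    by apply: nearW => k; exact: (hq k).1.1.
  move=> x; apply/andP; split.
    apply: ler_cvg_to (cvg_cst _) (hqq x) _; apply: nearW => k.
    by have /andP[] := (hq k).1.2 x.
  apply: ler_cvg_to (hqq x) (cvg_cst _) _; apply: nearW => k.
  by have /andP[] := (hq k).1.2 x.
exists q => // z hz; apply/eqP; rewrite -subr_eq0 -normc_eq0 eq_le normc_ge0 andbT.
set c := 2 * (plip z * (2 * pi)).
have c0 : 0 <= c by rewrite mulr_ge0 // mulr_ge0 // plip_ge0.
apply/ler_addgt0Pl => e e0; rewrite addr0.
(* Two Riemann-sum errors of at most [c / M] each have to fit into [e]. *)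
have [M Me] : exists M : nat, 2 * c / e < M%:R.
  by exists (Num.Def.trunc (2 * c / e)).+1; rewrite truncnS_gt.
have M0 : (0 < M)%N.
  rewrite -(ltr_nat R); apply: le_lt_trans Me.
  by apply: divr_ge0; [apply: mulr_ge0|apply: ltW].
have M0' : 0 < M%:R :> R by rewrite ltr0n.
have cM : 0 <= c / M%:R by rewrite divr_ge0.
(* For fixed [M] the Riemann sum uses finitely many values of [q_ k], so the bound passes to the
   ultralimit. *)
have H1 : normc (Phi z - riemann z q M) <= c / M%:R.
  apply: (cvgC_normc_le (F := U) (u := fun k => Phi_ k z - riemann z (q_ k) M)) => //.
    by move=> k; rewrite (hq k).2 //; apply: cint_riemann => //; exact: (hq k).1.
  apply: cvgCB; first exact: (ultra_cvgC_oo oU (hcvg z hz)).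
  apply: cvgCM; first exact: cvgC_cst.
  by apply: cvgC_sum => l; apply: cvgC_poisson.
have H2 := cint_riemann hz hquant M0; rewrite -/c in H2.
set I := cint _ _ in H2 *.
have -> : Phi z - I = (Phi z - riemann z q M) - (I - riemann z q M) by ring.
rewrite (le_trans (normcB _ _)) // (le_trans (lerD H1 H2)) //.
move: Me; rewrite -mulrDl ler_pdivrMr // ltr_pdivrMr //; clearbody c; lra.
Qed.

Lemma zeta_2pi : zeta (2 * pi) = zeta 0 :> C.
Proof. by rewrite /zeta mulr_natl cos2pi sin2pi cos0 sin0. Qed.

(** The measure is the law of the quantile function under the uniform law. *)
Lemma rep_measure Phi : rep Phi ->
  exists2 rho : probability mT R, PT rho &
    forall z, inD z -> 1 + psi rho z = Phi z.
Proof.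
move=> [q hq hPhi].
(* The value [2 * pi] is moved to [0] to stay in the half-open interval; [zeta] is the same at
   both. *)
pose X (t : mT) : mT := if q t < 2 * pi then q t else 0.
have mX : measurable_fun setT X.
  apply: measurable_fun_ifT => //; last exact: quantile_measurable.
  apply: measurable_fun_ltr => //; exact: quantile_measurable.
pose Xm := MeasurableFun.Pack (MeasurableFun.Class (isMeasurableFun.Build _ _ _ _ X mX)).
exists (distribution (unif01 R) Xm).
  rewrite /PT /distribution /pushforward /=.
  have -> : X @^-1` `[0, 2 * pi[%classic = setT.
    apply/seteqP; split => // t _ /=; rewrite in_itv /= /X.
    case: ifP => [->|_]; first by have /andP[->] := hq.2 t.
    by rewrite lexx mulr_gt0 // pi_gt0.
  exact: probability_setT.
move=> z hz; rewrite psi1E // hPhi //; have [c1 c2 [B hB]] := bcont_poisson hz.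
have E (g : C -> R) : continuous (fun t => g (poisson z t)) ->
    (forall t, `|g (poisson z t)| <= B) ->
    \int[distribution (unif01 R) Xm]_(t in setT) g (poisson z t) =
    \int[unif01 R]_(t in setT) g (poisson z (q t)).
  move=> cg gB; have mg := continuous_measurable_fun cg.
  rewrite /Rintegral integral_distribution.
  - congr fine; apply: eq_integral => t _ /=; congr (EFin (g _)).
    rewrite /X; case: ifPn => // h; rewrite /poisson -zeta_2pi.
    suff -> : q t = 2 * pi by [].
    by rewrite -leNgt in h; apply/eqP; rewrite eq_le h andbT; have /andP[] := hq.2 t.
  - exact/measurable_EFinP.
  - apply: (@bounded_integrable _ _ _ _ (fun t => g (poisson z (X t))) B) => //.
    exact: (measurableT_comp mg mX).
rewrite /cint; congr (_ +i* _).
  by apply: E => // t; exact: le_trans (normr_Re_le _) (hB t).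
by apply: E => // t; exact: le_trans (normr_Im_le _) (hB t).
Qed.

(** The quantile function jumps by [h] at each partial sum of the weights, so it equals [i * h] on a
    cell of length [a i]. *)
Lemma rep_atomic (N : nat) (a : nat -> R) : (forall j, 0 <= a j) ->
  \sum_(j < N) a j = 1 ->
  rep (fun z => \sum_(j < N) (a j)%:C * poisson z (j%:R * (2 * pi / N%:R))).
Proof.
move=> a0 a1; pose A i := \sum_(j < i) a j; set h := 2 * pi / N%:R.
have h0 : 0 <= h by rewrite divr_ge0 ?mulr_ge0 ?pi_ge0 //.
have AS i : A i <= A i.+1 by rewrite /A big_ord_recr lerDl.
have Am i j : (i <= j)%N -> A i <= A j.
  by move=> ij; apply: (homo_leq (@lexx _ _) (@le_trans _ _)).
have N0 : (0 < N)%N.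
  by case: (N) a1 => //; rewrite big_ord0 => /esym/eqP; rewrite oner_eq0.
pose q t := \sum_(j < N) (if A j.+1 <= t then h else 0).
have hq : quantile q.
  split.
    move=> x y xy; apply: ler_sum => j _; case: ifP => [hx|_].
      by rewrite (le_trans hx xy).
    by case: ifP.
  move=> x; apply/andP; split; first by apply: sumr_ge0 => j _; case: ifP.
  apply: le_trans (_ : \sum_(j < N) h <= _).
    by apply: ler_sum => j _; case: ifP.
  by rewrite sumr_const card_ord -[_ *+ N]mulr_natl mulrC mulfVK // pnatr_eq0 -lt0n.
have qE i t : (i < N)%N -> A i <= t < A i.+1 -> q t = i%:R * h.
  move=> iN /andP[t1 t2]; rewrite /q.
  have E (j : 'I_N) : (A j.+1 <= t) = (j < i)%N.
    have [ji|ij] := ltnP j i; first by rewrite (le_trans (Am _ _ ji)).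
    by apply/negbTE; rewrite -ltNge (lt_le_trans t2) // Am.
  under eq_bigr do rewrite E.
  rewrite -big_mkcond /= -(big_ord_widen _ (fun=> h) (ltnW iN)) sumr_const.
  by rewrite card_ord mulr_natl.
exists q => // z hz; have [c1 c2 [B hB]] := bcont_poisson hz.
have E (g : C -> R) : continuous (fun t => g (poisson z t)) ->
    (forall t, `|g (poisson z t)| <= B) ->
    \sum_(j < N) a j * g (poisson z (j%:R * h)) =
    \int[unif01 R]_(t in setT) g (poisson z (q t)).
  move=> cg gB; have mg := continuous_measurable_fun cg.
  have := @unif01_step R (fun t => g (poisson z (q t))) B A
    (fun i => g (poisson z (i%:R * h))) (fun=> 0) N.
  rewrite /A big_ord0 => /(_ _ (fun t => gB _) AS erefl a1).
  rewrite [X in _ <= X]big1 => [H|i _]; last by rewrite mul0r.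
  apply/eqP; rewrite eq_sym -subr_eq0 -normr_eq0 eq_le normr_ge0 andbT.
  rewrite (le_trans _ (H _ _)) //.
  - rewrite le_eqVlt; apply/orP; left; apply/eqP; congr (`|_ - _|).
    by apply: eq_bigr => i _; rewrite big_ord_recr /= addrAC subrr add0r mulrC.
  - by apply: measurableT_comp mg _; exact: quantile_measurable.
  - by move=> i iN t it; rewrite (qE i) // subrr normr0.
apply: complex_eqP; rewrite ?cRe_sum ?cIm_sum /=.
  under eq_bigr do rewrite cRe_scale.
  by apply: E => // t; exact: le_trans (normr_Re_le _) (hB t).
under eq_bigr do rewrite cIm_scale.
by apply: E => // t; exact: le_trans (normr_Im_le _) (hB t).
Qed.

End Representation.

(** * Quadrature of Schur functions on roots of unity *)

Section Herglotz.
Variable R : realType.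
Local Notation C := R[i].
Local Notation Re := complex.Re.
Implicit Types (z : C) (g h : C -> C).

(** The normalized partial sums [S_m] of the geometric series satisfy
    [S_(m+1) = r (h S_m) + (1 - r)], a convex combination of Schur functions. *)
Lemma schur_resolvent h (r : R) : schur h -> 0 <= r < 1 ->
  schur (fun z => (1 - r)%:C * (1 - r%:C * h z)^-1).
Proof.
move=> hh /andP[r0 r1]; have r01 : 0 <= r <= 1 by rewrite r0 ltW.
apply: (@schur_cvg _ \oo _ (fun m z => (1 - r)%:C * \sum_(k < m) (r%:C * h z) ^+ k)).
  elim=> [|m IH].
    apply: eq_schur (schur_cst (c := 0) _) => [z _|]; last by rewrite normc0.
    by rewrite big_ord0 mulr0.
  have s1 : schur (fun=> 1 : C) by apply: schur_cst; rewrite normc1.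
  apply: eq_schur (schur_conv r01 (schur_mul hh IH) s1) => z _.
  rewrite big_ord_recl expr0 mulrDr mulr1 addrC; congr (_ + _).
  rewrite !mulr_sumr; apply: eq_bigr => k _; rewrite lift0 exprS; ring.
move=> z hz; apply: cvgCM; first exact: cvgC_cst.
apply: cvgC_geometric; rewrite normcM normc_real ger0_norm //.
by rewrite (le_lt_trans _ r1) // ler_piMr // schur_le1.
Qed.

Lemma zetaD (s t : R) : zeta (s + t) = zeta s * zeta t :> C.
Proof.
by apply: complex_eqP; rewrite ?cReM ?cImM /= ?cosD ?sinD //; ring.
Qed.

Lemma zetaMn (t : R) n : zeta (n%:R * t) = zeta t ^+ n :> C.
Proof.
elim: n => [|n IH]; first by rewrite mul0r expr0 /zeta cos0 sin0.
by rewrite -natr1 mulrDl mul1r zetaD IH exprSr.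
Qed.

Lemma zeta_neq1 (t : R) : 0 < t < 2 * pi -> zeta t != 1 :> C.
Proof.
move=> /andP[t0 t1]; apply/eqP => /(congr1 (fun z : C => Re z)) /= ct.
have : 0 < sin (t / 2) by apply: sin_gt0_pi; apply/andP; split; lra.
have t2 : t = (t / 2) *+ 2 by rewrite mulr2n; lra.
move: ct; rewrite {1}t2 cos_mulr2n cos2sin2 mulr2n => ct s0; nra.
Qed.

(** The sum is geometric; for [m != l] its ratio [x] is an [N]-th root of unity other than [1]. *)
Lemma roots_orthogonal (N m l : nat) : (m < N)%N -> (l < N)%N ->
  \sum_(j < N) zeta (j%:R * (2 * pi / N%:R)) ^+ m *
    (zeta (j%:R * (2 * pi / N%:R)))^*%R ^+ l = (N * (m == l))%:R :> C.
Proof.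
move=> mN lN; set t : R := 2 * pi / N%:R.
have N0 : (0 < N%:R :> R) by rewrite ltr0n; exact: leq_ltn_trans mN.
have tN : N%:R * t = 2 * pi by rewrite mulrC mulfVK // gt_eqF.
have t0 : 0 < t by rewrite divr_gt0 // mulr_gt0 // pi_gt0.
pose w : C := zeta t; have wJ : w * w^*%R = 1 := zetaJ t.
have wN : w ^+ N = 1 by rewrite -zetaMn tN zeta_2pi /zeta cos0 sin0.
pose x := w ^+ m * w^*%R ^+ l.
transitivity (\sum_(j < N) x ^+ j).
  apply: eq_bigr => j _; rewrite zetaMn -/w conjX /x exprMn -!exprM.
  by rewrite [(j * m)%N]mulnC [(j * l)%N]mulnC.
have [ml|ml] := eqVneq m l.
  have -> : x = 1 by rewrite /x ml -exprMn wJ expr1n.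
  under eq_bigr do rewrite expr1n.
  by rewrite sumr_const card_ord muln1.
have H k : (0 < k < N)%N -> w ^+ k != 1.
  move=> /andP[k0 kN]; rewrite -zetaMn; apply: zeta_neq1.
  by rewrite mulr_gt0 ?ltr0n //= -tN ltr_pM2r // ltr_nat.
have x1 : x != 1.
  have [lm|ml'] := ltnP l m.
    have -> : x = w ^+ (m - l).
      by rewrite /x -{1}(subnK (ltnW lm)) exprD -mulrA -exprMn wJ expr1n mulr1.
    by apply: H; rewrite subn_gt0 lm (leq_ltn_trans (leq_subr _ _)).
  have {}ml : (m < l)%N by rewrite ltn_neqAle ml.
  have -> : x = (w ^+ (l - m))^*%R.
    rewrite /x -{1}(subnK ml') exprD mulrCA -exprMn wJ expr1n mulr1.
    by rewrite conjX.
  rewrite -conj1 (inj_eq (can_inj (@conjCK _))); apply: H.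
  by rewrite subn_gt0 ml (leq_ltn_trans (leq_subr _ _)).
have x1' : x - 1 != 0 by rewrite subr_eq0.
apply: (mulfI x1'); rewrite -subrX1 muln0 mulr0 /x exprMn -!exprM.
rewrite ![(_ * N)%N]mulnC !exprM wN -conjX wN conj1 !expr1n mulr1 subrr //.
Qed.

Definition node (N : nat) (j : nat) : R := j%:R * (2 * pi / N%:R).

(* Nodes of the disc; the measure has its atoms at the conjugate angles. *)
Definition dnode (r : R) (N j : nat) : C := r%:C * (zeta (node N j))^*%R.

Lemma normc_dnode r N j : 0 <= r -> normc (dnode r N j) = r.
Proof. by move=> r0; rewrite normcM normc_real normcJ normc_zeta mulr1 ger0_norm. Qed.

(** The tail bound is applied to the nodes together with [y], which gets the coefficient [-1]: the
    moment hypothesis kills all degrees below [M], and the coefficients have total modulus at most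
    [B + 1]. *)
Lemma schur_quadrature h (r B : R) (N M : nat) (b : nat -> C) (y : C) :
  schur h -> 0 <= r < 1 -> (0 < N)%N -> normc y <= r ->
  (forall j, normc (b j) <= B) ->
  (forall l, (l < M)%N ->
    \sum_(j < N) (N%:R^-1)%:C * b j * dnode r N j ^+ l = y ^+ l) ->
  normc (\sum_(j < N) (N%:R^-1)%:C * b j * h (dnode r N j) - h y) <=
    (B + 1) * r ^+ M / (1 - r).
Proof.
move=> hh /andP[r0 r1] N0 yr bB mom.
pose I := ('I_N + unit)%type.
pose p (i : I) := match i with inl j => dnode r N j | inr _ => y end.
pose a (i : I) := match i with inl j => (N%:R^-1)%:C * b j | inr _ => -1 end.
have S1 (V : zmodType) (f : I -> V) :
    \sum_i f i = \sum_(j < N) f (inl j) + f (inr tt).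
  by rewrite big_sumType; congr (_ + _); apply: big_pred1 => -[].
have := @schur_functional_tail R h I p a M r hh r1.
rewrite S1 mulN1r => H; apply: le_trans (H _ _) _.
- by case=> [j|u]; rewrite /p ?normc_dnode.
- by move=> l lM; rewrite S1 /a /p mom // mulN1r subrr.
have N0' : 0 < N%:R :> R by rewrite ltr0n.
rewrite ler_wpM2r ?invr_ge0 ?subr_ge0 ?(ltW r1) // ler_wpM2r ?exprn_ge0 //.
rewrite S1 /a normc_opp normc1 lerD2r.
apply: le_trans (_ : \sum_(j < N) N%:R^-1 * B <= _).
  apply: ler_sum => j _; rewrite normcM normc_real.
  by rewrite ger0_norm ?invr_ge0 ?ler0n // ler_wpM2l ?invr_ge0 ?ler0n.
by rewrite sumr_const card_ord -[_ *+ N]mulr_natl mulrA mulfV ?gt_eqF // mul1r.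
Qed.

(** The series of [poisson z] at a node, cut at degree [M] so that the moments become exact. *)
Definition dsum z (N M j : nat) : C := \sum_(m < M) z ^+ m * zeta (node N j) ^+ m.

Lemma normc_dsum z N M j : inD z -> normc (dsum z N M j) <= (1 - normc z)^-1.
Proof.
move=> hz; have z1 : 0 < 1 - normc z by rewrite subr_gt0; apply/inDE.
apply: le_trans (normc_sum _ _ _) _.
under eq_bigr do rewrite normcM !normcX normc_zeta expr1n mulr1.
rewrite -[leRHS]mul1r ler_pdivlMr // mulrC.
by rewrite geometric_sum gerBl exprn_ge0 ?normc_ge0.
Qed.

Lemma poisson_dsum z N M j : inD z ->
  normc (poisson z (node N j) - dsum z N M j) <= normc z ^+ M / (1 - normc z).
Proof.
move=> hz; have z1 : 0 < 1 - normc z by rewrite subr_gt0; apply/inDE.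
have h1 := sub1_zeta_neq0 (node N j) hz.
have -> : poisson z (node N j) - dsum z N M j =
    (z * zeta (node N j)) ^+ M * poisson z (node N j).
  rewrite /dsum; under eq_bigr do rewrite -exprMn.
  set x := z * zeta (node N j) in h1 *.
  apply: (mulfI h1); rewrite mulrBr.
  by rewrite geometric_sum /poisson -/x mulrCA mulfV //; ring.
rewrite normcM normcX normc_mul_zeta ler_wpM2l ?exprn_ge0 ?normc_ge0 //.
rewrite normcV lef_pV2 ?posrE ?sub1_zeta_ge //.
exact: lt_le_trans z1 (sub1_zeta_ge _ _).
Qed.

Lemma natCV (n : nat) : (0 < n)%N -> (n%:R^-1 : R)%:C * n%:R = 1 :> C.
Proof.
move=> n0; have -> : (n%:R : C) = (n%:R : R)%:C by rewrite rmorph_nat.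
by rewrite -realCM mulVf // pnatr_eq0 -lt0n.
Qed.

Lemma dsum_moment z r (M l : nat) : (l < M)%N ->
  \sum_(j < 2 * M) ((2 * M)%:R^-1)%:C * dsum z (2 * M) M j * dnode r (2 * M) j ^+ l
  = (r%:C * z) ^+ l.
Proof.
move=> lM; set N := (2 * M)%N.
have MN : (M <= N)%N by rewrite leq_pmull.
have N0 : (0 < N%:R :> R) by rewrite ltr0n (leq_trans _ MN) // (leq_ltn_trans _ lM).
transitivity (\sum_(m < M) \sum_(j < N) ((N%:R^-1)%:C * r%:C ^+ l * z ^+ m) *
    (zeta (node N j) ^+ m * (zeta (node N j))^*%R ^+ l)).
  rewrite exchange_big; apply: eq_bigr => j _ /=.
  rewrite /dsum mulr_sumr mulr_suml; apply: eq_bigr => m _.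
  by rewrite /dnode exprMn; ring.
rewrite (bigD1 (Ordinal lM)) //= [X in _ + X]big1 ?addr0 => [|m ml].
  rewrite -mulr_sumr roots_orthogonal ?(leq_trans lM) // eqxx muln1.
  transitivity ((N%:R^-1 : R)%:C * N%:R * (r%:C ^+ l * z ^+ l)); first by ring.
  by rewrite natCV ?mul1r ?exprMn // -(ltr_nat R).
rewrite -mulr_sumr roots_orthogonal ?(leq_trans lM) ?(leq_trans (ltn_ord m)) //.
by rewrite -val_eqE in ml; rewrite (negbTE ml) muln0 mulr0.
Qed.

(** Here the exponents add up, and [m + l < 2 * M] is the reason for taking [2 * M] nodes. Only
    [m = l = 0] survives; [0 ^+ l] is the moment of evaluation at [0]. *)
Lemma dsumJ_moment z r (M l : nat) : (l < M)%N ->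
  \sum_(j < 2 * M) ((2 * M)%:R^-1)%:C * (dsum z (2 * M) M j)^*%R *
    dnode r (2 * M) j ^+ l = 0 ^+ l.
Proof.
move=> lM; set N := (2 * M)%N.
have M0 : (0 < M)%N := leq_ltn_trans (leq0n _) lM.
have MN : (M <= N)%N by rewrite leq_pmull.
have N0 : (0 < N%:R :> R) by rewrite ltr0n (leq_trans M0).
transitivity (\sum_(m < M) \sum_(j < N) ((N%:R^-1)%:C * r%:C ^+ l * z^*%R ^+ m) *
    (zeta (node N j) ^+ 0 * (zeta (node N j))^*%R ^+ (m + l))).
  rewrite exchange_big; apply: eq_bigr => j _ /=.
  rewrite /dsum conj_sum mulr_sumr mulr_suml; apply: eq_bigr => m _.
  by rewrite /dnode exprMn conjM !conjX exprD; ring.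
have O m : (m < M)%N -> \sum_(j < N) ((N%:R^-1)%:C * r%:C ^+ l * z^*%R ^+ m) *
    (zeta (node N j) ^+ 0 * (zeta (node N j))^*%R ^+ (m + l)) =
    (N%:R^-1)%:C * r%:C ^+ l * z^*%R ^+ m * (N * (0 == m + l)%N)%:R.
  move=> mM; rewrite -mulr_sumr roots_orthogonal ?(leq_trans M0) //.
  by rewrite /N mul2n -addnn -addSn leq_add // ltnW.
rewrite (bigD1 (Ordinal M0)) //= [X in _ + X]big1 ?addr0 => [|m m0]; last first.
  rewrite O // eq_sym addn_eq0; rewrite -val_eqE /= in m0.
  by rewrite (negbTE m0) muln0 mulr0.
rewrite (O 0%N M0) add0n; case: l lM {O} => [|l] lM.
  by rewrite eqxx muln1 !expr0 !mulr1 natCV // -(ltr_nat R).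
by rewrite muln0 mulr0 expr0n.
Qed.

End Herglotz.

(** * Representation of resolvents by atomic measures *)

Section HerglotzRepresentation.
Variable R : realType.
Local Notation C := R[i].
Local Notation Re := complex.Re.
Variables (s : C -> C) (r : R).
Hypotheses (hs : schur s) (s0 : s 0 = 0) (r01 : 0 <= r < 1).

Let phi (z : C) : C := (1 - r%:C * s z)^-1.

Let r_ge0 : 0 <= r. Proof. by case/andP: r01. Qed.
Let r_lt1 : r < 1. Proof. by case/andP: r01. Qed.
Let r1_gt0 : 0 < 1 - r. Proof. by rewrite subr_gt0. Qed.

Let normc_rs z : inD z -> normc (r%:C * s z) <= r.
Proof.
move=> hz; rewrite normcM normc_real ger0_norm // ler_piMr //.
exact: schur_le1.
Qed.

Let normc_phi z : inD z -> normc (phi z) <= (1 - r)^-1.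
Proof.
move=> hz; have h : 1 - r <= normc (1 - r%:C * s z).
  by rewrite (le_trans _ (normc_sub1_ge _)) // lerB // normc_rs.
by rewrite normcV lef_pV2 ?posrE // (lt_le_trans r1_gt0).
Qed.

Let inD_dnode N j : inD (dnode r N j).
Proof. by apply/inDE; rewrite normc_dnode. Qed.

(** As [2 / (1 - x) - 1 = (1 + x) / (1 - x)], this is the Herglotz density
    [Re ((1 + r s) / (1 - r s))] at a node, divided by [N]. *)
Definition weight (N j : nat) : R := N%:R^-1 * (2 * Re (phi (dnode r N j)) - 1).

Let weight_gt0 N j : (0 < N)%N -> 0 < weight N j.
Proof.
move=> N0; rewrite mulr_gt0 ?invr_gt0 ?ltr0n // subr_gt0.
have := @Re_inv_sub1_gt R (r%:C * s (dnode r N j)).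
rewrite (le_lt_trans (normc_rs (inD_dnode N j))) // => /(_ isT).
by rewrite -/(phi _); lra.
Qed.

Let weight_le N j : `|weight N j| <= N%:R^-1 * (2 / (1 - r) + 1).
Proof.
rewrite normrM ger0_norm ?invr_ge0 ?ler0n // ler_wpM2l ?invr_ge0 ?ler0n //.
rewrite (le_trans (ler_normB _ _)) // normr1 lerD2r normrM ger0_norm //.
rewrite ler_wpM2l // (le_trans (normr_Re_le _)) //.
exact: normc_phi (inD_dnode N j).
Qed.

Let weightE N j : (weight N j)%:C =
  (N%:R^-1)%:C * (phi (dnode r N j) + (phi (dnode r N j))^*%R - 1).
Proof.
by rewrite realCM realCD realCN realCM addcJ rmorph_nat.
Qed.

(** The weight splits into [phi], its conjugate and [-1]. The first part reproduces [phi] at [r z],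
    the second the conjugate of [phi 0 = 1], and the last cancels this [1]. *)
Let quadrature_phi z M : inD z -> (0 < M)%N ->
  normc (\sum_(j < 2 * M) (weight (2 * M) j)%:C * dsum z (2 * M) M j -
    phi (r%:C * z)) <=
  2 * (((1 - normc z)^-1 + 1) / (1 - r) / (1 - r)) * r ^+ M.
Proof.
move=> hz M0; set N := (2 * M)%N.
have N0 : (0 < N)%N by rewrite muln_gt0.
set B := (1 - normc z)^-1.
have hrz : normc (r%:C * z) <= r.
  by rewrite normcM normc_real ger0_norm // ler_piMr // ltW //; apply/inDE.
have K (b : nat -> C) y : normc y <= r -> (forall j, normc (b j) <= B) ->
    (forall l, (l < M)%N ->
      \sum_(j < N) (N%:R^-1)%:C * b j * dnode r N j ^+ l = y ^+ l) ->
    normc (\sum_(j < N) (N%:R^-1)%:C * b j * phi (dnode r N j) - phi y) <=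
      (B + 1) / (1 - r) / (1 - r) * r ^+ M.
  move=> yr bB mom.
  (* [phi] is known to be Schur only after multiplication by [1 - r], hence the second division by
     [1 - r] in the bound. *)
  have := schur_quadrature (schur_resolvent hs r01) r01 N0 yr bB mom.
  rewrite -[X in normc (_ - X) <= _]/((1 - r)%:C * phi y).
  have -> : \sum_(j < N) (N%:R^-1)%:C * b j *
      ((1 - r)%:C * (1 - r%:C * s (dnode r N j))^-1) =
      (1 - r)%:C * \sum_(j < N) (N%:R^-1)%:C * b j * phi (dnode r N j).
    by rewrite mulr_sumr; apply: eq_bigr => j _; rewrite mulrCA.
  rewrite -mulrBr normcM normc_real gtr0_norm // mulrC -ler_pdivlMr //.
  by move=> /le_trans; apply; rewrite le_eqVlt; apply/orP; left; apply/eqP; ring.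
have T1 := K (dsum z N M) (r%:C * z) hrz (fun j => normc_dsum N M j hz)
  (fun l lM => dsum_moment z r lM).
have T2 : normc (\sum_(j < N) (N%:R^-1)%:C * dsum z N M j *
    (phi (dnode r N j))^*%R - 1) <= (B + 1) / (1 - r) / (1 - r) * r ^+ M.
  rewrite -normcJ conjD conjN conj1 conj_sum.
  have := K (fun j => (dsum z N M j)^*%R) 0 _ _ (fun l lM => dsumJ_moment z r lM).
  rewrite {2}/phi s0 mulr0 subr0 invr1 => K0.
  under eq_bigr do rewrite !conjM conj_real conjCK.
  by apply: K0; rewrite ?normc0 // => j; rewrite normcJ normc_dsum.
have T3 : \sum_(j < N) (N%:R^-1)%:C * dsum z N M j = 1.
  have := dsum_moment z r M0; rewrite expr0 => <-.
  by apply: eq_bigr => j _; rewrite expr0 mulr1.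
have -> : \sum_(j < N) (weight N j)%:C * dsum z N M j =
    \sum_(j < N) (N%:R^-1)%:C * dsum z N M j * phi (dnode r N j) +
    \sum_(j < N) (N%:R^-1)%:C * dsum z N M j * (phi (dnode r N j))^*%R - 1.
  rewrite -T3 -big_split -sumrB; apply: eq_bigr => j _ /=.
  by rewrite weightE; ring.
set S1 := \sum_(j < N) _ in T1 *; set S2 := \sum_(j < N) _ in T2 *.
have -> : S1 + S2 - 1 - phi (r%:C * z) = (S1 - phi (r%:C * z)) + (S2 - 1) by ring.
rewrite (le_trans (normcD _ _)) // (le_trans (lerD T1 T2)) //.
by rewrite le_eqVlt; apply/orP; left; apply/eqP; ring.
Qed.

Definition quad_poisson (M : nat) (z : C) : C :=
  \sum_(j < 2 * M) (weight (2 * M) j)%:C * poisson z (node R (2 * M) j).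

(** Passing from [dsum] to the full kernel costs a geometric tail, uniform over the nodes, while the
    total mass of the weights stays bounded. *)
Lemma quad_poisson_cvg z : inD z ->
  cvgC \oo (fun k => quad_poisson k.+1 z) (phi (r%:C * z)).
Proof.
move=> hz; have z1 : 0 < 1 - normc z by rewrite subr_gt0; apply/inDE.
set c1 := 2 * (((1 - normc z)^-1 + 1) / (1 - r) / (1 - r)).
set c2 := (2 / (1 - r) + 1) / (1 - normc z).
apply: (@cvgC_bound _ _ _ _ _ (fun k => c1 * r ^+ k.+1 + c2 * normc z ^+ k.+1)).
  move=> k; set M := k.+1; set N := (2 * M)%N.
  have N0 : 0 < N%:R :> R by rewrite ltr0n muln_gt0.
  have -> : quad_poisson M z - phi (r%:C * z) =
    (\sum_(j < N) (weight N j)%:C * dsum z N M j - phi (r%:C * z)) +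
    \sum_(j < N) (weight N j)%:C * (poisson z (node R N j) - dsum z N M j).
    rewrite addrAC; congr (_ - _); rewrite -big_split; apply: eq_bigr => j _ /=.
    ring.
  rewrite (le_trans (normcD _ _)) // lerD //; first exact: quadrature_phi.
  apply: le_trans (normc_sum _ _ _) _.
  apply: le_trans (_ : \sum_(j < N) N%:R^-1 * (c2 * normc z ^+ M) <= _).
    apply: ler_sum => j _; rewrite normcM normc_real.
    apply: le_trans (ler_pM _ _ (weight_le N j) (poisson_dsum N M j hz)) _ => //.
      exact: normc_ge0.
    by rewrite le_eqVlt /c2; apply/orP; left; apply/eqP; ring.
  by rewrite sumr_const card_ord -[_ *+ N]mulr_natl mulrA mulfV ?gt_eqF // mul1r.
rewrite -[X in _ --> X](addr0 0); apply: cvgD.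
  by have := geometric_cvg0 c1 r01; rewrite -cvg_shiftS; exact.
have z01 : 0 <= normc z < 1 by rewrite normc_ge0 -subr_gt0.
by have := geometric_cvg0 c2 z01; rewrite -cvg_shiftS; exact.
Qed.

(** The positive weights have a total [P] that only tends to [1], as the limit at [z = 0] shows;
    dividing by [P] gives probabilities. The shift to [k.+1] avoids an empty sum. *)
Lemma rep_resolvent : rep (fun z => (1 - r%:C * s (r%:C * z))^-1).
Proof.
pose P M := \sum_(j < 2 * M) weight (2 * M) j.
have P0 k : 0 < P k.+1.
  rewrite /P mulnS big_ord_recl /= ltr_pwDl ?weight_gt0 // sumr_ge0 // => j _.
  by rewrite ltW // weight_gt0.
pose Phi_ k (z : C) := ((P k.+1)^-1)%:C * quad_poisson k.+1 z.
apply: (@rep_cvg _ Phi_) => [k|z hz].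
  have a0 j : 0 <= (P k.+1)^-1 * weight (2 * k.+1) j.
    by rewrite mulr_ge0 ?invr_ge0 ?(ltW (P0 k)) ?(ltW (weight_gt0 _ _)).
  have a1 : \sum_(j < 2 * k.+1) (P k.+1)^-1 * weight (2 * k.+1) j = 1.
    by rewrite -mulr_sumr mulVf // gt_eqF.
  have [q hq E] := rep_atomic a0 a1; exists q => // z hz; rewrite -E //.
  rewrite /Phi_ /quad_poisson mulr_sumr; apply: eq_bigr => j _.
  by rewrite mulrA -realCM.
have cP : cvgC \oo (fun k => (P k.+1)%:C) 1.
  have := quad_poisson_cvg (inD0 R).
  rewrite mulr0 /phi s0 mulr0 subr0 invr1; apply: eq_cvgC => k.
  rewrite /quad_poisson /P rmorph_sum; apply: eq_bigr => j _.
  by rewrite /poisson mul0r subr0 invr1 mulr1.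
rewrite -[X in cvgC _ _ X]mul1r -[X in cvgC _ _ (X * _)]invr1.
apply: cvgCM; last exact: quad_poisson_cvg.
apply: eq_cvgC (cvgCV (oner_neq0 _) cP) => k; by rewrite realCV.
Qed.

End HerglotzRepresentation.

(** * From Schur functions to measures and convolution roots *)

Section Main.
Variable R : realType.
Local Notation C := R[i].
Implicit Types (z : C) (mu nu rho : probability (measurableTypeR R) R).

Lemma rep_schur (g : C -> C) : schur g -> rep (fun z => (1 - z * g z)^-1).
Proof.
move=> hg; pose s z := z * g z.
have hs : schur s by apply: schur_mul hg; exact: schur_id.
have s0 : s 0 = 0 by rewrite /s mul0r.
(* [1 - r k] is a square, to match the squared modulus in [schur_radial]. *)
pose r k : R := 1 - harmonic k ^+ 2.
have h01 k : 0 < (harmonic k : R) <= 1.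
  by rewrite harmonic_gt0 /= invf_le1 ?ler1n ?ltr0n.
have r01 k : 0 <= r k < 1.
  have /andP[h0 h1] := h01 k.
  by rewrite subr_ge0 expr_le1 ?(ltW h0) // h1 /= gtrBl exprn_gt0.
apply: rep_cvg (fun k => rep_resolvent hs s0 (r01 k)) _ => z hz.
have z1 := normc_lt1_sqr hz.
have c1 : cvgC \oo (fun k => (r k)%:C) 1.
  apply: (@cvgC_bound _ _ _ _ _ harmonic); last exact: cvg_harmonic.
  move=> k; have /andP[h0 h1] := h01 k.
  rewrite -realC1 -realCN -realCD normc_real /r addrAC subrr sub0r normrN.
  by rewrite ger0_norm ?sqr_ge0 // expr2 ler_piMl // ltW.
have c2 : cvgC \oo (fun k => s ((r k)%:C * z)) (s z).
  apply: (@cvgC_bound _ _ _ _ _ (fun k => harmonic k * (1 - normc z ^+ 2)^-1)).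
    move=> k; have /andP[h0 h1] := h01 k; have /andP[r0 r1] := r01 k.
    rewrite normc_distC -ler_sqr ?nnegrE ?normc_ge0 ?divr_ge0 ?(ltW z1) ?(ltW h0) //.
    apply: le_trans (schur_radial hs hz _) _; first by rewrite r0 ltW.
    have -> : 1 - r k = harmonic k ^+ 2 by rewrite /r subKr.
    by rewrite expr_div_n.
  rewrite -[X in _ --> X](mul0r (1 - normc z ^+ 2)^-1).
  by apply: cvgM; [exact: cvg_harmonic|exact: cvg_cst].
apply: cvgCV.
  apply: sub1_neq0; rewrite normcM; have /inDE hz' := hz; apply: le_lt_trans hz'.
  by rewrite ler_piMr ?normc_ge0 // schur_le1.
apply: cvgCB; first exact: cvgC_cst.
by rewrite -[z * g z]mul1r; exact: cvgCM.
Qed.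

(** Here [eta = 1 - 1 / (1 + psi)], and the representing measure has
    [1 + psi = 1 / (1 - z g(z))]. *)
Lemma schur_eta (g : C -> C) : schur g ->
  exists2 rho, PT rho & forall z, inD z -> Defs.eta rho z = z * g z.
Proof.
move=> hg; have [rho PTrho H] := rep_measure (rep_schur hg).
exists rho => // z hz; have h := psi1_neq0 rho hz.
have E : Defs.eta rho z = 1 - (1 + psi rho z)^-1.
  by rewrite /Defs.eta; field.
by rewrite E H // invrK; ring.
Qed.

Lemma bool_powE rho (g : C -> C) n z :
  (forall z, inD z -> Defs.eta rho z = z * g z) -> inD z -> z != 0 ->
  bool_pow rho n.+1 z = z * g z ^+ n.+1.
Proof.
move=> H hz z0; elim: n => [|n IH]; first exact: H.
have E : bool_pow rho n.+2 z = Defs.eta rho z * bool_pow rho n.+1 z / z by [].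
by rewrite E IH H // [g z ^+ n.+2]exprS; field.
Qed.

Lemma ID_cm_bool mu nu : ID_cm mu nu -> ID_bool mu.
Proof.
move=> ID n n2; have [g sg Hg] := ID_cm_root ID (ltnW n2).
have [rho PTrho Hrho] := schur_eta sg; exists rho; split => // z hz.
case: n n2 Hg => [//|[//|n]] _ Hg.
have [->|z0] := eqVneq z 0; last by rewrite (bool_powE _ Hrho) // Hg // eta_hfun.
(* At [0] the quotient is [0] because [0^-1 = 0], in agreement with [eta mu 0 = 0]. *)
have -> : bool_pow rho n.+2 0 = Defs.eta rho 0 * bool_pow rho n.+1 0 / 0 by [].
by rewrite eta0 invr0 mulr0.
Qed.

Lemma mono_powE rho n z : mono_pow rho n.+1 z = iter n.+1 (Defs.eta rho) z.
Proof. by elim: n => // n IH; rewrite [RHS]iterS -IH. Qed.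

Lemma ID_cm_mono mu nu : ID_cm mu nu -> ID_mono nu.
Proof.
move=> ID n n2; have [mu1 [nu1 [_ [PT1 H]]]] := ID n n2; exists nu1; split => // z hz.
by case: n n2 H => // n _ H; rewrite (H z hz).2 mono_powE (cm_powE _ _ _ hz).2.
Qed.

(** For equal components, [eta w = w * hfun w] collapses the product in [cm_powE] to the iterate of
    [eta]. *)
Lemma ID_mono_cm nu : ID_mono nu -> ID_cm nu nu.
Proof.
move=> ID n n2; have [rho [PT1 H]] := ID n n2.
exists rho, rho; split => //; split => // z hz.
case: n n2 H => // n _ H; rewrite H // mono_powE.
have [-> ->] := cm_powE rho rho n hz; split => //.
elim: (n.+1) => [|k IH]; first by rewrite big_ord0 mulr1.
by rewrite big_ord_recr /= mulrA -IH eta_hfun //; exact: inD_iter_eta.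
Qed.

End Main.

Theorem theorem5p12 (R : realType) :
  (forall mu nu : probability (measurableTypeR R) R,
     PT mu -> PT nu -> ID_cm mu nu -> ID_bool mu /\ ID_bool nu) /\
  (forall mu : probability (measurableTypeR R) R,
     PT mu -> ID_mono mu -> ID_bool mu).
Proof.
split=> [mu nu _ _ ID|mu _ ID].
  split; first exact: ID_cm_bool ID.
  exact: ID_cm_bool (ID_mono_cm (ID_cm_mono ID)).
exact: ID_cm_bool (ID_mono_cm ID).
Qed.
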